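(* Let $\mathcal I$ be a tensor ideal of $\mathcal T$ satisfying the standing assumption in the context, and let $z_1,z_2\in\mathbb Q(q)$ be the scalars for which $\sigma_+-\sigma_-=z_1(1_2-\mathsf U)+z_2(\mathsf H-\mathsf N)$ in $\mathcal T/\mathcal I$. Then $$z_1=z_2=\frac{q^{-4}-q^4}{[3]}.$$
   Context: $[n]=\frac{q^n-q^{-n}}{q-q^{-1}}$. **Monoidal notation.** $\mathbb 1$ is the unit object, morphisms compose right to left ($fg=f\circ g$), $1$ denotes the identity of the object $\mathsf I$, and $1_n$ the identity of $\mathsf I^{\otimes n}$. (String diagrams are read bottom to top; $m$ is a trivalent merge; $\sigma_+$ is the crossing in which the strand from bottom left to top right passes over, $\sigma_-$ the opposite crossing.) **The category $\mathcal T$.** Let $\Bbbk=\mathbb Q(q)$, $\tau=q^{12}$, $\beta=q^{24}$, $\delta=\frac{[3][8][13][18]}{[4][6][9]}$, $\phi=\frac{[2][7][12]}{[4][6]}$. $\mathcal T$ is the strict $\Bbbk$-linear monoidal category generated by one object $\mathsf I$ and morphisms $m:\mathsf I^{\otimes2}\to\mathsf I$, $\sigma_+,\sigma_-:\mathsf I^{\otimes 2}\to\mathsf I^{\otimes2}$, $\cup:\mathbb1\to\mathsf I^{\otimes2}$, $\cap:\mathsf I^{\otimes2}\to\mathbb1$, subject to: (R1) $(\cap\otimes1)(1\otimes\cup)=1=(1\otimes\cap)(\cup\otimes1)$; (R2) $(1\otimes m)(\cup\otimes1)=(m\otimes1)(1\otimes\cup)$; this common morphism $\mathsf I\to\mathsf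 I^{\otimes2}$ is denoted $s$; (R3) $(1\otimes\cap)(\sigma_-\otimes1)=(\cap\otimes1)(1\otimes\sigma_+)$ and $(1\otimes\cap)(\sigma_+\otimes1)=(\cap\otimes1)(1\otimes\sigma_-)$; (R4) $\sigma_-\sigma_+=1_2=\sigma_+\sigma_-$; (R5) $(\sigma_+\otimes1)(1\otimes\sigma_+)(\sigma_+\otimes1)=(1\otimes\sigma_+)(\sigma_+\otimes1)(1\otimes\sigma_+)$; (R6) $(1\otimes m)(\sigma_+\otimes1)(1\otimes\sigma_+)=\sigma_+(m\otimes1)$; (R7) $(1\otimes\sigma_+)(\sigma_+\otimes1)(1\otimes s)=(s\otimes1)\sigma_+$; (R8) $\cap\sigma_+=\beta\cap$, $m\sigma_+=\tau m$, $ms=\phi 1$, $\cap\cup=\delta1_{\mathbb1}$, $m\cup=0$. Put $\mathsf U=\cup\cap$, $\mathsf H=(m\otimes1)(1\otimes s)=(1\otimes m)(s\otimes1)$, $\mathsf N=sm$. **Standing assumption.** $\delta\notin\{q^4+q^{-4},\,-q^{16}-q^{-16}\}$, and $\mathcal I$ is a tensor ideal of $\mathcal T$ such that $1_2,\ \mathsf U,\ \mathsf H,\ \mathsf N,\ \sigma_++\sigma_-$ form a $\Bbbk$-basis of $(\mathcal T/\mathcal I)(\mathsf I^{\otimes2},\mathsf I^{\otimes2})$. The same symbols denote morphisms of $\mathcal T$ and their images in $\mathcal T/\mathcal I$. (Under this assumption scalars $z_1,z_2$ as in the claim exist and are unique.) *)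

(* Defs.v *)
From HB Require Import structures.
From mathcomp Require Import all_boot all_order all_algebra.
From mathcomp Require Import boolp.

Set Implicit Arguments.
Unset Strict Implicit.
Unset Printing Implicit Defensive.

Import GRing.Theory.
Local Open Scope ring_scope.
Local Open Scope quotient_scope.

Definition K : fieldType := {fraction {poly rat}}.

Definition q : K := @tofrac {poly rat} 'X.

Definition qint (n : nat) : K := (q ^+ n - q ^- n) / (q - q^-1).

Definition tau : K := q ^+ 12.
Definition beta : K := q ^+ 24.
Definition delta : K :=
  (qint 3 * qint 8 * qint 13 * qint 18) / (qint 4 * qint 6 * qint 9).
Definition phi : K := (qint 2 * qint 7 * qint 12) / (qint 4 * qint 6).

(** Formal morphisms. The object n stands for the n-th tensor power of the
    generating object, so that the tensor product of objects is addition and the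
    unit object is 0. The generators are the trivalent merge, the crossing with
    the strand from bottom left to top right on top, its inverse, the cup and
    the cap; diagrams are read from bottom to top and composed right to left. *)
Inductive term : nat -> nat -> Type :=
  | t_id n : term n n
  | t_comp a b c : term b c -> term a b -> term a c
  | t_tens a b c d : term a b -> term c d -> term (a + c) (b + d)
  | t_zero a b : term a b
  | t_add a b : term a b -> term a b -> term a b
  | t_scale a b : K -> term a b -> term a b
  | t_m : term 2 1
  | t_sp : term 2 2
  | t_sm : term 2 2
  | t_cup : term 0 2
  | t_cap : term 2 0.

Arguments t_zero {a b}.

Declare Scope term_scope.
Delimit Scope term_scope with T.
Bind Scope term_scope with term.
Notation "f ⊗ g" := (t_tens f g) (at level 40, left associativity) : term_scope.
Notation "f ∘ g" := (t_comp f g) (at level 45, right associativity) : term_scope.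
Notation "f ⊞ g" := (t_add f g) (at level 50, left associativity) : term_scope.
Notation "k • f" := (t_scale k f) (at level 42, right associativity) : term_scope.
Notation "'𝟙' n" := (t_id n) (at level 9, n at level 8) : term_scope.

(** Transport along equalities of objects: (a + b) + c and a + (b + c), as well
    as a + 0 and a, are equal but not convertible. *)
Definition t_cast a a' b b' (ea : a = a') (eb : b = b') (f : term a b) :
    term a' b' :=
  ecast x (term x b') ea (ecast y (term a y) eb f).

Definition t_s : term 1 2 := (𝟙 1 ⊗ t_m) ∘ (t_cup ⊗ 𝟙 1).

Reserved Notation "f ≈ g" (at level 70, no associativity).

(** The smallest congruence making terms into a strict K-linear monoidal
    category and satisfying the relations teq_zigzagl to teq_lollipop between the generators. *)
Inductive teq : forall a b, term a b -> term a b -> Prop :=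
  | teq_refl a b (f : term a b) : f ≈ f
  | teq_sym a b (f g : term a b) : f ≈ g -> g ≈ f
  | teq_trans a b (f g h : term a b) : f ≈ g -> g ≈ h -> f ≈ h
  | teq_comp a b c (f f' : term b c) (g g' : term a b) :
      f ≈ f' -> g ≈ g' -> f ∘ g ≈ f' ∘ g'
  | teq_tens a b c d (f f' : term a b) (g g' : term c d) :
      f ≈ f' -> g ≈ g' -> f ⊗ g ≈ f' ⊗ g'
  | teq_add a b (f f' g g' : term a b) :
      f ≈ f' -> g ≈ g' -> f ⊞ g ≈ f' ⊞ g'
  | teq_scale a b k (f f' : term a b) : f ≈ f' -> k • f ≈ k • f'
  | teq_addA a b (f g h : term a b) : f ⊞ (g ⊞ h) ≈ (f ⊞ g) ⊞ h
  | teq_addC a b (f g : term a b) : f ⊞ g ≈ g ⊞ f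
  | teq_add0 a b (f : term a b) : t_zero ⊞ f ≈ f
  | teq_addN a b (f : term a b) : (-1) • f ⊞ f ≈ t_zero
  | teq_scaleA a b k l (f : term a b) : k • (l • f) ≈ (k * l)%R • f
  | teq_scale1 a b (f : term a b) : 1 • f ≈ f
  | teq_scaleDr a b k (f g : term a b) : k • (f ⊞ g) ≈ k • f ⊞ k • g
  | teq_scaleDl a b k l (f : term a b) : (k + l)%R • f ≈ k • f ⊞ l • f
  | teq_compA a b c d (f : term c d) (g : term b c) (h : term a b) :
      f ∘ (g ∘ h) ≈ (f ∘ g) ∘ h
  | teq_comp1f a b (f : term a b) : 𝟙 b ∘ f ≈ f
  | teq_compf1 a b (f : term a b) : f ∘ 𝟙 a ≈ f
  | teq_tensA a b c d e g (x : term a b) (y : term c d) (z : term e g) :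
      t_cast (esym (addnA a c e)) (esym (addnA b d g)) ((x ⊗ y) ⊗ z)
        ≈ x ⊗ (y ⊗ z)
  | teq_tens1f a b (f : term a b) : 𝟙 0 ⊗ f ≈ f
  | teq_tensf1 a b (f : term a b) :
      t_cast (addn0 a) (addn0 b) (f ⊗ 𝟙 0) ≈ f
  | teq_tens_id a b : 𝟙 a ⊗ 𝟙 b ≈ 𝟙 (a + b)
  | teq_interchange a b c a' b' c' (f : term b c) (g : term a b)
      (f' : term b' c') (g' : term a' b') :
      (f ∘ g) ⊗ (f' ∘ g') ≈ (f ⊗ f') ∘ (g ⊗ g')
  | teq_compDl a b c (f f' : term b c) (g : term a b) :
      (f ⊞ f') ∘ g ≈ (f ∘ g) ⊞ (f' ∘ g)
  | teq_compDr a b c (f : term b c) (g g' : term a b) :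
      f ∘ (g ⊞ g') ≈ (f ∘ g) ⊞ (f ∘ g')
  | teq_compZl a b c k (f : term b c) (g : term a b) :
      (k • f) ∘ g ≈ k • (f ∘ g)
  | teq_compZr a b c k (f : term b c) (g : term a b) :
      f ∘ (k • g) ≈ k • (f ∘ g)
  | teq_tensDl a b c d (f f' : term a b) (g : term c d) :
      (f ⊞ f') ⊗ g ≈ (f ⊗ g) ⊞ (f' ⊗ g)
  | teq_tensDr a b c d (f : term a b) (g g' : term c d) :
      f ⊗ (g ⊞ g') ≈ (f ⊗ g) ⊞ (f ⊗ g')
  | teq_tensZl a b c d k (f : term a b) (g : term c d) :
      (k • f) ⊗ g ≈ k • (f ⊗ g)
  | teq_tensZr a b c d k (f : term a b) (g : term c d) :
      f ⊗ (k • g) ≈ k • (f ⊗ g)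
  | teq_zigzagl : @teq 1 1 ((t_cap ⊗ 𝟙 1) ∘ (𝟙 1 ⊗ t_cup)) (𝟙 1)
  | teq_zigzagr : @teq 1 1 ((𝟙 1 ⊗ t_cap) ∘ (t_cup ⊗ 𝟙 1)) (𝟙 1)
  | teq_split : @teq 1 2 t_s ((t_m ⊗ 𝟙 1) ∘ (𝟙 1 ⊗ t_cup))
  | teq_cap_sm :
      @teq 3 1 ((𝟙 1 ⊗ t_cap) ∘ (t_sm ⊗ 𝟙 1)) ((t_cap ⊗ 𝟙 1) ∘ (𝟙 1 ⊗ t_sp))
  | teq_cap_sp :
      @teq 3 1 ((𝟙 1 ⊗ t_cap) ∘ (t_sp ⊗ 𝟙 1)) ((t_cap ⊗ 𝟙 1) ∘ (𝟙 1 ⊗ t_sm))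
  | teq_smK : t_sm ∘ t_sp ≈ 𝟙 2
  | teq_spK : t_sp ∘ t_sm ≈ 𝟙 2
  | teq_braid :
      @teq 3 3 ((t_sp ⊗ 𝟙 1) ∘ (𝟙 1 ⊗ t_sp) ∘ (t_sp ⊗ 𝟙 1))
               ((𝟙 1 ⊗ t_sp) ∘ (t_sp ⊗ 𝟙 1) ∘ (𝟙 1 ⊗ t_sp))
  | teq_m_sp :
      @teq 3 2 ((𝟙 1 ⊗ t_m) ∘ (t_sp ⊗ 𝟙 1) ∘ (𝟙 1 ⊗ t_sp))
               (t_sp ∘ (t_m ⊗ 𝟙 1))
  | teq_sp_s :
      @teq 2 3 ((𝟙 1 ⊗ t_sp) ∘ (t_sp ⊗ 𝟙 1) ∘ (𝟙 1 ⊗ t_s))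
               ((t_s ⊗ 𝟙 1) ∘ t_sp)
  | teq_cap_twist : t_cap ∘ t_sp ≈ beta • t_cap
  | teq_m_twist : t_m ∘ t_sp ≈ tau • t_m
  | teq_bigon : t_m ∘ t_s ≈ phi • 𝟙 1
  | teq_loop : t_cap ∘ t_cup ≈ delta • 𝟙 0
  | teq_lollipop : t_m ∘ t_cup ≈ t_zero
where "f ≈ g" := (@teq _ _ f%T g%T).

HB.instance Definition _ a b := gen_eqMixin (term a b).
HB.instance Definition _ a b := gen_choiceMixin (term a b).

Section Hom.
Variables a b : nat.

Definition teqb (f g : term a b) : bool := `[< f ≈ g >].

Fact teqb_refl : reflexive teqb.
Proof. by move=> f; apply/asboolP; exact: teq_refl. Qed.

Fact teqb_sym : symmetric teqb.
Proof. by move=> f g; apply/asboolP/asboolP; exact: teq_sym. Qed.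

Fact teqb_trans : transitive teqb.
Proof.
by move=> g f h /asboolP fg /asboolP gh; apply/asboolP; exact: teq_trans gh.
Qed.

Canonical teqb_equiv := EquivRel teqb teqb_refl teqb_sym teqb_trans.

(** The morphisms from the a-th to the b-th tensor power in the category T. *)
Definition hom := {eq_quot teqb_equiv}.

HB.instance Definition _ := Choice.on hom.
HB.instance Definition _ := Quotient.on hom.

Definition cls (f : term a b) : hom := \pi_hom f.

Lemma clsP (f g : term a b) : cls f = cls g <-> f ≈ g.
Proof.
by split=> [/eqmodP/asboolP|fg] //; apply/eqmodP/asboolP.
Qed.

Lemma reprP (f : term a b) : repr (cls f) ≈ f.
Proof. by apply/clsP; rewrite /cls reprK. Qed.

Lemma homW (P : hom -> Prop) : (forall f, P (cls f)) -> forall x, P x.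
Proof. by move=> Pf x; rewrite -[x]reprK; exact: Pf. Qed.

Definition hzero : hom := cls t_zero.
Definition hadd (x y : hom) : hom := cls (repr x ⊞ repr y)%T.
Definition hscale (k : K) (x : hom) : hom := cls (k • repr x)%T.
Definition hopp (x : hom) : hom := hscale (-1) x.

Lemma haddE f g : hadd (cls f) (cls g) = cls (f ⊞ g)%T.
Proof. by apply/clsP; apply: teq_add; exact: reprP. Qed.

Lemma hscaleE k f : hscale k (cls f) = cls (k • f)%T.
Proof. by apply/clsP; apply: teq_scale; exact: reprP. Qed.

Fact haddA : associative hadd.
Proof.
elim/homW=> f; elim/homW=> g; elim/homW=> h; rewrite !haddE.
by apply/clsP; exact: teq_addA.
Qed.

Fact haddC : commutative hadd.
Proof.
by elim/homW=> f; elim/homW=> g; rewrite !haddE; apply/clsP; exact: teq_addC.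
Qed.

Fact hadd0 : left_id hzero hadd.
Proof. by elim/homW=> f; rewrite haddE; apply/clsP; exact: teq_add0. Qed.

Fact haddN : left_inverse hzero hopp hadd.
Proof.
by elim/homW=> f; rewrite /hopp hscaleE haddE; apply/clsP; exact: teq_addN.
Qed.

HB.instance Definition _ := GRing.isZmodule.Build hom haddA haddC hadd0 haddN.

Fact hscaleA k l (x : hom) : hscale k (hscale l x) = hscale (k * l) x.
Proof.
by elim/homW: x => f; rewrite !hscaleE; apply/clsP; exact: teq_scaleA.
Qed.

Fact hscale1 : left_id 1 hscale.
Proof. by elim/homW=> f; rewrite hscaleE; apply/clsP; exact: teq_scale1. Qed.

Fact hscaleDr : right_distributive hscale +%R.
Proof.
move=> k; elim/homW=> f; elim/homW=> g.
by rewrite /GRing.add /= !(haddE, hscaleE); apply/clsP; exact: teq_scaleDr.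
Qed.

Fact hscaleDl (x : hom) : {morph hscale^~ x : k l / k + l}.
Proof.
move=> k l; elim/homW: x => f.
by rewrite !hscaleE /GRing.add /= haddE; apply/clsP; exact: teq_scaleDl.
Qed.

HB.instance Definition _ := GRing.Zmodule_isLmodule.Build K hom
  hscaleA hscale1 hscaleDr hscaleDl.

Lemma cls0 : cls t_zero = 0. Proof. by []. Qed.

Lemma clsD f g : cls (f ⊞ g)%T = cls f + cls g.
Proof. by rewrite -haddE. Qed.

Lemma clsZ k f : cls (k • f)%T = k *: cls f.
Proof. by rewrite -hscaleE. Qed.

End Hom.

Definition idm n : hom n n := cls (𝟙 n)%T.

Definition comp a b c (f : hom b c) (g : hom a b) : hom a c :=
  cls (repr f ∘ repr g)%T.

Definition tens a b c d (f : hom a b) (g : hom c d) : hom (a + c) (b + d) :=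
  cls (repr f ⊗ repr g)%T.

Definition cast a a' b b' (ea : a = a') (eb : b = b') (f : hom a b) :
    hom a' b' :=
  ecast x (hom x b') ea (ecast y (hom a y) eb f).

Declare Scope mor_scope.
Delimit Scope mor_scope with M.
Notation "f ⊗ g" := (tens f g) : mor_scope.
Notation "f ∘ g" := (comp f g) : mor_scope.
Notation "'𝟙' n" := (idm n) : mor_scope.
Local Open Scope mor_scope.

Lemma comp_cls a b c (f : term b c) (g : term a b) :
  cls f ∘ cls g = cls (f ∘ g)%T.
Proof. by apply/clsP; apply: teq_comp; exact: reprP. Qed.

Lemma tens_cls a b c d (f : term a b) (g : term c d) :
  cls f ⊗ cls g = cls (f ⊗ g)%T.
Proof. by apply/clsP; apply: teq_tens; exact: reprP. Qed.

Lemma comp_cls3 a b c d (f : term c d) (g : term b c) (h : term a b) :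
  cls f ∘ cls g ∘ cls h = cls (f ∘ g ∘ h)%T.
Proof. by rewrite !comp_cls. Qed.

Lemma cast_cls a a' b b' (ea : a = a') (eb : b = b') (f : term a b) :
  cast ea eb (cls f) = cls (t_cast ea eb f).
Proof. by case: a' / ea; case: b' / eb. Qed.

Lemma cast_id a b (ea : a = a) (eb : b = b) (f : hom a b) : cast ea eb f = f.
Proof. by rewrite (eq_irrelevance ea erefl) (eq_irrelevance eb erefl). Qed.

Lemma compA a b c d (f : hom c d) (g : hom b c) (h : hom a b) :
  f ∘ (g ∘ h) = (f ∘ g) ∘ h.
Proof.
elim/homW: f => f; elim/homW: g => g; elim/homW: h => h.
by rewrite !comp_cls; apply/clsP; exact: teq_compA.
Qed.

Lemma comp1f a b (f : hom a b) : 𝟙 b ∘ f = f.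
Proof. by elim/homW: f => f; rewrite comp_cls; apply/clsP; constructor. Qed.

Lemma compf1 a b (f : hom a b) : f ∘ 𝟙 a = f.
Proof. by elim/homW: f => f; rewrite comp_cls; apply/clsP; constructor. Qed.

Lemma tensA a b c d e g (x : hom a b) (y : hom c d) (z : hom e g) :
  cast (esym (addnA a c e)) (esym (addnA b d g)) ((x ⊗ y) ⊗ z) = x ⊗ (y ⊗ z).
Proof.
elim/homW: x => x; elim/homW: y => y; elim/homW: z => z.
by rewrite !tens_cls cast_cls; apply/clsP; exact: teq_tensA.
Qed.

Lemma tens1f a b (f : hom a b) : 𝟙 0 ⊗ f = f.
Proof. by elim/homW: f => f; rewrite tens_cls; apply/clsP; exact: teq_tens1f. Qed.

Lemma tensf1 a b (f : hom a b) : cast (addn0 a) (addn0 b) (f ⊗ 𝟙 0) = f.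
Proof.
by elim/homW: f => f; rewrite tens_cls cast_cls; apply/clsP; exact: teq_tensf1.
Qed.

Lemma tens_id a b : 𝟙 a ⊗ 𝟙 b = 𝟙 (a + b).
Proof. by rewrite tens_cls; apply/clsP; exact: teq_tens_id. Qed.

Lemma interchange a b c a' b' c' (f : hom b c) (g : hom a b)
    (f' : hom b' c') (g' : hom a' b') :
  (f ∘ g) ⊗ (f' ∘ g') = (f ⊗ f') ∘ (g ⊗ g').
Proof.
elim/homW: f => f; elim/homW: g => g; elim/homW: f' => f'; elim/homW: g' => g'.
by rewrite !(comp_cls, tens_cls); apply/clsP; exact: teq_interchange.
Qed.

Lemma compDl a b c (f f' : hom b c) (g : hom a b) :
  (f + f') ∘ g = f ∘ g + f' ∘ g.
Proof.
elim/homW: f => f; elim/homW: f' => f'; elim/homW: g => g.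
by rewrite -clsD !comp_cls -clsD; apply/clsP; exact: teq_compDl.
Qed.

Lemma compDr a b c (f : hom b c) (g g' : hom a b) :
  f ∘ (g + g') = f ∘ g + f ∘ g'.
Proof.
elim/homW: f => f; elim/homW: g => g; elim/homW: g' => g'.
by rewrite -clsD !comp_cls -clsD; apply/clsP; exact: teq_compDr.
Qed.

Lemma compZl a b c k (f : hom b c) (g : hom a b) : (k *: f) ∘ g = k *: (f ∘ g).
Proof.
elim/homW: f => f; elim/homW: g => g.
by rewrite -clsZ !comp_cls -clsZ; apply/clsP; exact: teq_compZl.
Qed.

Lemma compZr a b c k (f : hom b c) (g : hom a b) : f ∘ (k *: g) = k *: (f ∘ g).
Proof.
elim/homW: f => f; elim/homW: g => g.
by rewrite -clsZ !comp_cls -clsZ; apply/clsP; exact: teq_compZr.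
Qed.

Lemma tensDl a b c d (f f' : hom a b) (g : hom c d) :
  (f + f') ⊗ g = f ⊗ g + f' ⊗ g.
Proof.
elim/homW: f => f; elim/homW: f' => f'; elim/homW: g => g.
by rewrite -clsD !tens_cls -clsD; apply/clsP; exact: teq_tensDl.
Qed.

Lemma tensDr a b c d (f : hom a b) (g g' : hom c d) :
  f ⊗ (g + g') = f ⊗ g + f ⊗ g'.
Proof.
elim/homW: f => f; elim/homW: g => g; elim/homW: g' => g'.
by rewrite -clsD !tens_cls -clsD; apply/clsP; exact: teq_tensDr.
Qed.

Lemma tensZl a b c d k (f : hom a b) (g : hom c d) :
  (k *: f) ⊗ g = k *: (f ⊗ g).
Proof.
elim/homW: f => f; elim/homW: g => g.
by rewrite -clsZ !tens_cls -clsZ; apply/clsP; exact: teq_tensZl.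
Qed.

Lemma tensZr a b c d k (f : hom a b) (g : hom c d) :
  f ⊗ (k *: g) = k *: (f ⊗ g).
Proof.
elim/homW: f => f; elim/homW: g => g.
by rewrite -clsZ !tens_cls -clsZ; apply/clsP; exact: teq_tensZr.
Qed.

Definition mrg : hom 2 1 := cls t_m.
Definition sigmap : hom 2 2 := cls t_sp.
Definition sigmam : hom 2 2 := cls t_sm.
Definition cup : hom 0 2 := cls t_cup.
Definition cap : hom 2 0 := cls t_cap.

(** The trivalent split s; it is also the other rotation of m (splE2). *)
Definition spl : hom 1 2 := (𝟙 1 ⊗ mrg) ∘ (cup ⊗ 𝟙 1).

Definition UU : hom 2 2 := cup ∘ cap.
Definition HH : hom 2 2 := (mrg ⊗ 𝟙 1) ∘ (𝟙 1 ⊗ spl).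
Definition NN : hom 2 2 := spl ∘ mrg.

Lemma splE : spl = cls t_s.
Proof. by rewrite /spl /idm !tens_cls comp_cls. Qed.

Lemma cap_cup :
  (cap ⊗ 𝟙 1) ∘ (𝟙 1 ⊗ cup) = 𝟙 1 :> hom 1 1 /\
  (𝟙 1 ⊗ cap) ∘ (cup ⊗ 𝟙 1) = 𝟙 1 :> hom 1 1.
Proof.
split; rewrite !tens_cls comp_cls; apply/clsP.
  exact: teq_zigzagl.
exact: teq_zigzagr.
Qed.

Lemma splE2 : (𝟙 1 ⊗ mrg) ∘ (cup ⊗ 𝟙 1) = (mrg ⊗ 𝟙 1) ∘ (𝟙 1 ⊗ cup) :> hom 1 2.
Proof. by rewrite !tens_cls !comp_cls; apply/clsP; exact: teq_split. Qed.

Lemma cap_sigma :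
  (𝟙 1 ⊗ cap) ∘ (sigmam ⊗ 𝟙 1) = (cap ⊗ 𝟙 1) ∘ (𝟙 1 ⊗ sigmap) :> hom 3 1 /\
  (𝟙 1 ⊗ cap) ∘ (sigmap ⊗ 𝟙 1) = (cap ⊗ 𝟙 1) ∘ (𝟙 1 ⊗ sigmam) :> hom 3 1.
Proof.
split; rewrite !tens_cls !comp_cls; apply/clsP.
  exact: teq_cap_sm.
exact: teq_cap_sp.
Qed.

Lemma sigmaK : sigmam ∘ sigmap = 𝟙 2 /\ sigmap ∘ sigmam = 𝟙 2.
Proof. by split; rewrite comp_cls; apply/clsP; constructor. Qed.

Lemma sigma_braid :
  (sigmap ⊗ 𝟙 1) ∘ (𝟙 1 ⊗ sigmap) ∘ (sigmap ⊗ 𝟙 1) =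
  (𝟙 1 ⊗ sigmap) ∘ (sigmap ⊗ 𝟙 1) ∘ (𝟙 1 ⊗ sigmap) :> hom 3 3.
Proof.
rewrite !tens_cls; apply: (etrans (@comp_cls3 3 3 3 3 _ _ _)).
apply: (etrans _ (esym (@comp_cls3 3 3 3 3 _ _ _))).
by apply/clsP; exact: teq_braid.
Qed.

Lemma mrg_sigma :
  (𝟙 1 ⊗ mrg) ∘ (sigmap ⊗ 𝟙 1) ∘ (𝟙 1 ⊗ sigmap) =
  sigmap ∘ (mrg ⊗ 𝟙 1) :> hom 3 2.
Proof.
rewrite !tens_cls; apply: (etrans (@comp_cls3 3 3 3 2 _ _ _)).
apply: (etrans _ (esym (@comp_cls 3 2 2 _ _))).
by apply/clsP; exact: teq_m_sp.
Qed.

Lemma sigma_spl :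
  (𝟙 1 ⊗ sigmap) ∘ (sigmap ⊗ 𝟙 1) ∘ (𝟙 1 ⊗ spl) =
  (spl ⊗ 𝟙 1) ∘ sigmap :> hom 2 3.
Proof.
rewrite splE !tens_cls; apply: (etrans (@comp_cls3 2 3 3 3 _ _ _)).
apply: (etrans _ (esym (@comp_cls 2 2 3 _ _))).
by apply/clsP; exact: teq_sp_s.
Qed.

Lemma local_relations :
  [/\ cap ∘ sigmap = beta *: cap, mrg ∘ sigmap = tau *: mrg,
      mrg ∘ spl = phi *: 𝟙 1, cap ∘ cup = delta *: 𝟙 0 & mrg ∘ cup = 0].
Proof.
by rewrite splE; split; rewrite !comp_cls -?cls0 -?clsZ; apply/clsP; constructor.
Qed.

Lemma HHE : HH = (𝟙 1 ⊗ mrg) ∘ (spl ⊗ 𝟙 1) :> hom 2 2.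
Proof.
rewrite [in RHS]/spl splE2 /HH /spl.
have -> : 𝟙 1 ⊗ ((𝟙 1 ⊗ mrg) ∘ (cup ⊗ 𝟙 1)) =
    (𝟙 1 ⊗ (𝟙 1 ⊗ mrg)) ∘ (𝟙 1 ⊗ (cup ⊗ 𝟙 1)) :> hom 2 3.
  by rewrite -(interchange (𝟙 1) (𝟙 1)) comp1f.
have -> : ((mrg ⊗ 𝟙 1) ∘ (𝟙 1 ⊗ cup)) ⊗ 𝟙 1 =
    ((mrg ⊗ 𝟙 1) ⊗ 𝟙 1) ∘ ((𝟙 1 ⊗ cup) ⊗ 𝟙 1) :> hom 2 3.
  by rewrite -(interchange _ _ (𝟙 1) (𝟙 1)) comp1f.
have <- := tensA (𝟙 1) cup (𝟙 1); have <- := tensA (𝟙 1) (𝟙 1) mrg.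
have := tensA mrg (𝟙 1) (𝟙 1); rewrite !(cast_id) => ->.
rewrite !compA; congr (_ ∘ _).
rewrite !tens_id.
have := interchange mrg (𝟙 2) (𝟙 1) mrg.
have := interchange (𝟙 1) mrg mrg (𝟙 2).
by rewrite !comp1f !compf1 => <- <-.
Qed.

Record tensor_ideal := TensorIdeal {
  ideal_mem : forall a b, hom a b -> Prop;
  ideal0 : forall a b, ideal_mem (0 : hom a b);
  idealD : forall a b (f g : hom a b),
    ideal_mem f -> ideal_mem g -> ideal_mem (f + g);
  idealZ : forall a b (k : K) (f : hom a b), ideal_mem f -> ideal_mem (k *: f);
  ideal_compl : forall a b c (f : hom b c) (g : hom a b),
    ideal_mem g -> ideal_mem (f ∘ g);
  ideal_compr : forall a b c (f : hom b c) (g : hom a b),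
    ideal_mem f -> ideal_mem (f ∘ g);
  ideal_tensl : forall a b c d (f : hom a b) (g : hom c d),
    ideal_mem g -> ideal_mem (f ⊗ g);
  ideal_tensr : forall a b c d (f : hom a b) (g : hom c d),
    ideal_mem f -> ideal_mem (f ⊗ g)
}.

Section QuotientHom.
Variables (I : tensor_ideal) (a b : nat).

Definition ieqb (f g : hom a b) : bool := `[< ideal_mem I (f - g) >].

Fact ieqb_refl : reflexive ieqb.
Proof. by move=> f; apply/asboolP; rewrite subrr; exact: ideal0. Qed.

Fact ieqb_sym : symmetric ieqb.
Proof.
by move=> f g; apply/asboolP/asboolP => /(idealZ (-1)); rewrite scaleN1r opprB.
Qed.

Fact ieqb_trans : transitive ieqb.
Proof.
move=> g f h /asboolP fg /asboolP gh; apply/asboolP.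
by have := idealD fg gh; rewrite addrA subrK.
Qed.

Canonical ieqb_equiv := EquivRel ieqb ieqb_refl ieqb_sym ieqb_trans.

(** The morphisms from the a-th to the b-th tensor power in T/I. *)
Definition qhom := {eq_quot ieqb_equiv}.

HB.instance Definition _ := Choice.on qhom.
HB.instance Definition _ := Quotient.on qhom.

Definition qcls (f : hom a b) : qhom := \pi_qhom f.

Lemma qclsP (f g : hom a b) : qcls f = qcls g <-> ideal_mem I (f - g).
Proof.
by split=> [/eqmodP/asboolP|fg] //; apply/eqmodP/asboolP.
Qed.

Lemma qreprP (f : hom a b) : ideal_mem I (repr (qcls f) - f).
Proof. by apply/qclsP; rewrite /qcls reprK. Qed.

Lemma qhomW (P : qhom -> Prop) : (forall f, P (qcls f)) -> forall x, P x.
Proof. by move=> Pf x; rewrite -[x]reprK; exact: Pf. Qed.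

Definition qadd (x y : qhom) : qhom := qcls (repr x + repr y).
Definition qscale (k : K) (x : qhom) : qhom := qcls (k *: repr x).
Definition qopp (x : qhom) : qhom := qscale (-1) x.

Lemma qaddE f g : qadd (qcls f) (qcls g) = qcls (f + g).
Proof.
by apply/qclsP; rewrite opprD addrACA; apply: idealD; exact: qreprP.
Qed.

Lemma qscaleE k f : qscale k (qcls f) = qcls (k *: f).
Proof. by apply/qclsP; rewrite -scalerBr; apply: idealZ; exact: qreprP. Qed.

Fact qaddA : associative qadd.
Proof. by do 3![elim/qhomW=> ?]; rewrite !qaddE addrA. Qed.

Fact qaddC : commutative qadd.
Proof. by do 2![elim/qhomW=> ?]; rewrite !qaddE addrC. Qed.

Fact qadd0 : left_id (qcls 0) qadd.
Proof. by elim/qhomW=> f; rewrite qaddE add0r. Qed.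

Fact qaddN : left_inverse (qcls 0) qopp qadd.
Proof. by elim/qhomW=> f; rewrite /qopp qscaleE qaddE scaleN1r addNr. Qed.

HB.instance Definition _ := GRing.isZmodule.Build qhom qaddA qaddC qadd0 qaddN.

Fact qscaleA k l (x : qhom) : qscale k (qscale l x) = qscale (k * l) x.
Proof. by elim/qhomW: x => f; rewrite !qscaleE scalerA. Qed.

Fact qscale1 : left_id 1 qscale.
Proof. by elim/qhomW=> f; rewrite qscaleE scale1r. Qed.

Fact qscaleDr : right_distributive qscale +%R.
Proof.
move=> k; elim/qhomW=> f; elim/qhomW=> g.
by rewrite [qcls f + _]qaddE [RHS]/GRing.add /= !qscaleE qaddE scalerDr.
Qed.

Fact qscaleDl (x : qhom) : {morph qscale^~ x : k l / k + l}.
Proof.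
move=> k l; elim/qhomW: x => f.
by rewrite [RHS]/GRing.add /= !qscaleE qaddE scalerDl.
Qed.

HB.instance Definition _ := GRing.Zmodule_isLmodule.Build K qhom
  qscaleA qscale1 qscaleDr qscaleDl.

Fact qcls_linear : linear qcls.
Proof.
move=> k f g.
suff: qadd (qscale k (qcls f)) (qcls g) = qcls (k *: f + g) by move/esym.
by rewrite qscaleE qaddE.
Qed.

HB.instance Definition _ := GRing.isLinear.Build K (hom a b) qhom _ qcls
  qcls_linear.

End QuotientHom.

(** The sequence e is a basis of V, as an ordered family: linearly independent
    and spanning. (basis_of would require V to be known in advance to be
    finite-dimensional.) *)
Definition is_basis (F : fieldType) (V : lmodType F) (e : seq V) : Prop :=
  (forall c : 'I_(size e) -> F,
      \sum_(i < size e) c i *: e`_i = 0 -> forall i, c i = 0) /\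
  (forall v : V, exists c : 'I_(size e) -> F,
      v = \sum_(i < size e) c i *: e`_i).

(* Main.v *)
(** Write [D = sigma_+ - sigma_-]. Modulo the span of [U] and [N], the skein
    relation makes [H] an affine function of [D], so the quotient of
    [End(I^2)] is spanned by [1, sigma_+, sigma_-]. Two relations then determine
    [sigma_+^2] and [sigma_-^2]:
    - [H^2] is invariant under the quarter turn, which exchanges [1] with [U], [H]
      with [N] and [sigma_+] with [sigma_-]; hence
      [H^2 = x (1 + U) + h (H + N) + w (sigma_+ + sigma_-)];
    - wiring the skein relation between a split and a merge on its right gives
      [tau^-1 H sigma_+ - tau H sigma_- = z1 (phi - N) + l H - z2 H^2], where
      [l = tau - tau^-1 - z1 + z2 phi], because a strand slides past a vertex and
      [m sigma_± = tau^±1 m].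
    Consistency with [sigma_+ sigma_- = 1] and with the action of [H^2] on [N]
    leaves, for the coefficient [rho] of [sigma_+] in [sigma_-^2], the equation
    [tau rho^3 = 1]. As Q(q) has no primitive cube root of unity, [rho = q^-4].
    What remains, together with the relation obtained by capping off, is linear
    in [z1], and its leading coefficient is a nonzero multiple of
    [delta - q^4 - q^-4]. *)

Require Import Defs.
From mathcomp Require Import all_boot all_order all_algebra.
From HB Require Import structures.
From mathcomp Require Import boolp ring.

Set Implicit Arguments.
Unset Strict Implicit.
Unset Printing Implicit Defensive.

Import Order.TTheory GRing.Theory Num.Theory.
(* [hom] of all_algebra would shadow ours. *)
Import Defs.

Local Open Scope ring_scope.

(** * The scalar equations *)

(* Here sigma_+^2 = a sigma_+ + b + c sigma_- and sigma_-^2 = a' sigma_+ + b' +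
   c' sigma_- modulo U and N, y = z2 phi, and x, h, w are the coefficients of
   H^2 scaled by z2^2, z2 and z2^2. The quartic satisfied by sigma_+ always has
   the root -1; whether the minimal cubic has it too is the dichotomy [dich]. *)
Lemma scalar_system (F : fieldType) (t z y l x h w a b c a' b' c' : F) :
  2%:R != 0 :> F -> t != 0 -> t - 1 != 0 -> 1 + t != 0 -> t ^+ 2 + 1 != 0 ->
  y != 0 ->
  l = t - t^-1 - z + y ->
  l ^+ 2 = x + h * (l + y) + w * (t + t^-1) ->
  a + a' = z *+ 2 + w + h ->
  c + c' = - z *+ 2 + w - h ->
  b + b' = 2%:R - z ^+ 2 + x - h * z ->
  (1 + t^-1) * a + (1 + t) * a' = t^-1 * z + l + z *+ 2 ->
  (1 + t^-1) * c + (1 + t) * c' = - (t * z + l + z *+ 2) ->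
  (1 + t^-1) * b + (1 + t) * b' =
    t + t^-1 + 2%:R + z * y - l * z - z ^+ 2 ->
  c * a' = 1 -> c * b' = - a -> c * c' = - b ->
  t * a' ^+ 3 = 1 /\
  t * a' * (t * a' - 1) * y =
    (1 + t) * (1 - a') * (t * a' * z - ((t * a') ^+ 2 - 1)).
Proof.
move=> n2 t0 t1 tN1 t2 y0 El EQ Ea Ec Eb Fa Fc Fb ca cb cc.
have c0 : c != 0 by apply: contra_eq_neq ca => ->; rewrite mul0r eq_sym oner_eq0.
have r0 : a' != 0 by apply: contra_eq_neq ca => ->; rewrite mulr0 eq_sym oner_eq0.
have cE : c = a'^-1 by apply: (mulIf r0); rewrite ca mulVf.
have b'E : b' = - (a * a') by rewrite -[LHS]mul1r -ca mulrAC cb mulNr.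
have c'E : c' = - (b * a') by rewrite -[LHS]mul1r -ca mulrAC cc mulNr.
(* As (1 + t) / (1 + t^-1) = t, [Fa] expresses [a] through [a'], and below [Fc] does the same for
   [b]; all unknowns become functions of t, z, y and a'. *)
have aE : a = z + t - 1 + t / (1 + t) * y - t * a'.
  have -> : a = ((1 + t^-1) * a + (1 + t) * a') * (t / (1 + t)) - t * a'.
    by field; rewrite t0 tN1.
  by rewrite Fa El; field; rewrite t0 tN1.
have bE : b = (a'^-1 + t * z + t - 1 + t / (1 + t) * y) / (t * a').
  have -> : b = (a'^-1 - ((1 + t^-1) * c + (1 + t) * c') * (t / (1 + t))) / (t * a').
    by rewrite cE c'E; field; rewrite t0 r0 tN1.
  by rewrite Fc El; field; rewrite t0 r0 tN1.
(* The combination Fa - Fb + Fc amounts to setting sigma_+ = -1; up to sign, [1 + a - b + c] is the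
   value at -1 of X^3 - a X^2 - b X - c. *)
have dich : (1 + t * a') * (1 + a - b + c) = 0.
  transitivity (t / (1 + t) * ((1 + t^-1) * a + (1 + t) * a'
     + ((1 + t^-1) * c + (1 + t) * c')
     - ((1 + t^-1) * b + (1 + t) * b')) + (1 + t)).
    by rewrite cE b'E c'E; field; rewrite t0 r0 tN1.
  by rewrite Fa Fb Fc El; field; rewrite t0 tN1.
have hE : h = (a + a' - c - c') / 2%:R - z *+ 2.
  have -> : a + a' - c - c' = (a + a') - (c + c') by ring.
  by rewrite Ea Ec; field.
have wE : w = (a + a' + c + c') / 2%:R.
  have -> : a + a' + c + c' = (a + a') + (c + c') by ring.
  by rewrite Ea Ec; field.
have xE : x = b + b' - 2%:R + z ^+ 2 + h * z by rewrite Eb; ring.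
(* If the first factor vanishes, a' = -t^-1 turns [EQ] into y (t - 1) (t^2 + 1) = 0, which is
   excluded. *)
move/eqP: dich; rewrite mulf_eq0 => /orP[] /eqP dich.
  have r' : a' = - t^-1.
    by apply: (mulfI t0); rewrite mulrN divff //; apply/eqP; rewrite -addr_eq0 addrC dich.
  have : y * ((t - 1) * (t ^+ 2 + 1)) = 0.
    transitivity ((l ^+ 2 - (x + h * (l + y) + w * (t + t^-1))) * - (t * (1 + t))).
      rewrite xE hE wE cE b'E c'E El bE aE r'; field.
      by rewrite n2 t0 tN1 ?oppr_eq0 ?oner_eq0.
    by rewrite -EQ subrr mul0r.
  by move/eqP; rewrite !mulf_eq0 (negPf y0) (negPf t1) (negPf t2).
have lin : t * a' * (t * a' - 1) * y =
    (1 + t) * (1 - a') * (t * a' * z - ((t * a') ^+ 2 - 1)).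
  apply/eqP; rewrite -subr_eq0; apply/eqP.
  transitivity ((1 + a - b + c) * (t * a' ^+ 2 * (1 + t))).
    by rewrite cE bE aE; field; rewrite t0 r0 tN1.
  by rewrite dich; ring.
split=> //.
(* For a' = 1 the equation [lin] would read t (t - 1) y = 0. Hence [lin] can be solved for z, and
   [EQ] then factors. *)
have r1 : 1 - a' != 0.
  apply/eqP => r1; move: lin; rewrite r1 mulr0 mul0r.
  have -> : a' = 1 by apply/esym/eqP; rewrite -subr_eq0 r1.
  by rewrite mulr1; apply/eqP; rewrite !mulf_neq0.
have zE : z = (t * a' * (t * a' - 1) * y / ((1 + t) * (1 - a'))
                + ((t * a') ^+ 2 - 1)) / (t * a').
  by rewrite lin; field; rewrite t0 r0 r1 tN1.
have : y * ((t - 1) * (t * a' ^+ 3 - 1)) = 0.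
  transitivity ((l ^+ 2 - (x + h * (l + y) + w * (t + t^-1))) * - (t * a' * (1 - a'))).
    rewrite xE hE wE cE b'E c'E El bE aE zE; field.
    by rewrite n2 t0 tN1 r0 r1.
  by rewrite -EQ subrr mul0r.
by move/eqP; rewrite !mulf_eq0 (negPf y0) (negPf t1) subr_eq0 => /eqP.
Qed.

(** * The field Q(q) *)

(** A test for nonvanishing in Q(q): look at the constant term. *)
Lemma tofrac_neq0 (p : {poly rat}) : p.[0] != 0 -> tofrac p != 0 :> K.
Proof. by move=> p0; rewrite tofrac_eq0; apply: contraNneq p0 => ->; rewrite horner0. Qed.

Lemma q_neq0 : q != 0.
Proof. by rewrite tofrac_eq0 polyX_eq0. Qed.

Lemma qX_neq0 n : q ^+ n != 0.
Proof. by rewrite expf_neq0 ?q_neq0. Qed.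

Lemma natK_neq0 n : n.+1%:R != 0 :> K.
Proof.
rewrite -(rmorph_nat (@tofrac {poly rat})) tofrac_neq0 //.
by rewrite hornerMn hornerC pnatr_eq0.
Qed.

Lemma qX_sub1_neq0 n : q ^+ n.+1 - 1 != 0.
Proof.
rewrite /q -rmorphXn -(rmorph1 (@tofrac {poly rat})) -rmorphB tofrac_neq0 //.
by rewrite !hornerE exprS mul0r sub0r oppr_eq0 oner_eq0.
Qed.

Lemma qX_add1_neq0 n : q ^+ n.+1 + 1 != 0.
Proof.
rewrite /q -rmorphXn -(rmorph1 (@tofrac {poly rat})) -rmorphD tofrac_neq0 //.
by rewrite !hornerE exprS mul0r add0r oner_eq0.
Qed.

Lemma fracP (R : idomainType) (x : {fraction R}) :
  exists n d : R, d != 0 /\ x * tofrac d = tofrac n.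
Proof.
pose r := repr x.
have -> : x = \pi_(FracField.type R)%qT r by rewrite reprK.
exists (\n_r), (\d_r); split; first exact: denom_ratioP.
unlock FracField.tofrac; rewrite -[LHS]FracField.pi_mul; apply/eqP.
rewrite FracField.equivf_def /FracField.mulf /=.
rewrite !numden_Ratio ?oner_neq0 ?mulr1 ?denom_ratioP //.
by rewrite mulrC.
Qed.

Lemma quad_form_eq0 (R : realFieldType) (u v : R) :
  u ^+ 2 + u * v + v ^+ 2 = 0 -> v = 0.
Proof.
have -> : u ^+ 2 + u * v + v ^+ 2 = (u + v / 2) ^+ 2 + 3 * (v / 2) ^+ 2 by field.
have ge3 : 0 <= 3 * (v / 2) ^+ 2 by rewrite pmulr_rge0 ?ltr0n // sqr_ge0.
move/eqP; rewrite paddr_eq0 ?sqr_ge0 // => /andP[_].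
rewrite mulf_eq0 pnatr_eq0 /= expf_eq0 /= mulf_eq0 invr_eq0 pnatr_eq0 orbF.
by move/eqP.
Qed.

(** Evaluation at each natural number reduces to the definite form over the rationals, so [d] has
    more roots than its degree allows. *)
Lemma quad_form_poly_eq0 (n d : {poly rat}) : n ^+ 2 + n * d + d ^+ 2 = 0 -> d = 0.
Proof.
move=> nd; apply/eqP; apply: contraT => d0.
have root_d (k : nat) : root d k%:R.
  move/(congr1 (fun p => p.[k%:R])): nd; rewrite !hornerE.
  by move/quad_form_eq0 => /rootP.
have := @max_poly_roots _ d [seq k%:R | k <- iota 0 (size d)] d0.
rewrite size_map size_iota ltnn; apply.
  by apply/allP => _ /mapP[k _ ->].
by rewrite map_inj_uniq ?iota_uniq //; exact: (mulrIn (oner_neq0 _)).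
Qed.

Lemma cube_sub1 (F : comNzRingType) (x : F) :
  x ^+ 3 - 1 = (x - 1) * (x ^+ 2 + x * 1 + 1 ^+ 2).
Proof. by ring. Qed.

Lemma quad_formM (F : comNzRingType) (x d : F) :
  (x * d) ^+ 2 + x * d * d + d ^+ 2 = (x ^+ 2 + x * 1 + 1 ^+ 2) * d ^+ 2.
Proof. by ring. Qed.

(** Clearing the denominator of a root of x^2 + x + 1 would give polynomials with n^2 + n d + d^2 =
    0, hence d = 0. *)
Lemma cube_eq1 (x : K) : x ^+ 3 = 1 -> x = 1.
Proof.
move/eqP; rewrite -subr_eq0 cube_sub1 mulf_eq0 subr_eq0 => /orP[/eqP//|/eqP x2].
have [n [d [d0 xd]]] := fracP x.
case/negP: d0; apply/eqP/(@quad_form_poly_eq0 n)/eqP.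
rewrite -tofrac_eq0 !(rmorphD, rmorphM, rmorphXn) /= -xd.
by rewrite quad_formM x2 mul0r.
Qed.

Lemma tau_neq0 : tau != 0. Proof. exact: qX_neq0. Qed.
Lemma beta_neq0 : beta != 0. Proof. exact: qX_neq0. Qed.
Lemma tau_sub1_neq0 : tau - 1 != 0. Proof. exact: qX_sub1_neq0. Qed.
Lemma tau_add1_neq0 : 1 + tau != 0. Proof. by rewrite addrC; exact: qX_add1_neq0. Qed.
Lemma tau_sqr_neq0 : tau ^+ 2 + 1 != 0.
Proof. by rewrite -exprM; exact: qX_add1_neq0. Qed.
Lemma beta_tau : beta = tau * tau. Proof. by rewrite -exprD. Qed.

(** [8]/[4] and [3][18]/([6][9]) are Laurent polynomials; only [13] contributes the denominator x^2
    - 1. *)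
Lemma loop_closed_form (F : fieldType) (x : F)
    (br := fun n => (x ^+ n - x ^- n) / (x - x^-1)) :
  x != 0 -> (forall n, x ^+ n.+1 - 1 != 0) ->
  (br 3 * br 8 * br 13 * br 18) / (br 4 * br 6 * br 9) =
  (x ^+ 8 + 1) * (x ^+ 12 - x ^+ 6 + 1) * (x ^+ 26 - 1)
    / (x ^+ 22 * (x ^+ 2 - 1)).
Proof.
move=> x0 xn; rewrite /br; field.
by rewrite x0 -expr2 -!exprM !xn.
Qed.

Lemma bigon_closed_form (F : fieldType) (x : F)
    (br := fun n => (x ^+ n - x ^- n) / (x - x^-1)) :
  x != 0 -> (forall n, x ^+ n.+1 - 1 != 0) ->
  (br 2 * br 7 * br 12) / (br 4 * br 6) =
  (x ^+ 8 - x ^+ 4 + 1) * (x ^+ 14 - 1) / (x ^+ 10 * (x ^+ 2 - 1)).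
Proof.
move=> x0 xn; rewrite /br; field.
by rewrite x0 -expr2 -!exprM !xn.
Qed.

(** Here rho = x^-4 has been inserted in [lin], and [yE] comes from capping off. Eliminating y
    leaves a linear equation whose coefficient of z is x^8 (x^8 - 1) (d - x^4 - x^-4). *)
Lemma solve_linear (F : fieldType) (x t z y d : F) :
  x != 0 -> (forall n, x ^+ n.+1 - 1 != 0) -> t = x ^+ 12 ->
  d = (x ^+ 8 + 1) * (x ^+ 12 - x ^+ 6 + 1) * (x ^+ 26 - 1)
    / (x ^+ 22 * (x ^+ 2 - 1)) ->
  d != x ^+ 4 + x ^- 4 ->
  y = t * t - (t * t)^-1 + z * (d - 1) ->
  t * x ^- 4 * (t * x ^- 4 - 1) * y =
    (1 + t) * (1 - x ^- 4) * (t * x ^- 4 * z - ((t * x ^- 4) ^+ 2 - 1)) ->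
  z = (x ^- 4 - x ^+ 4) / ((x ^+ 3 - x ^- 3) / (x - x^-1)) /\
  y = (x ^+ 8 - x ^+ 4 + 1) * (x ^+ 14 - 1) / (x ^+ 10 * (x ^+ 2 - 1)) * z.
Proof.
move=> x0 xn tE dE d4 yE lin; rewrite {t}tE in yE lin.
have zE : z = (x ^- 4 - x ^+ 4) / ((x ^+ 3 - x ^- 3) / (x - x^-1)).
  apply/eqP; rewrite -subr_eq0.
  have : (z - (x ^- 4 - x ^+ 4) / ((x ^+ 3 - x ^- 3) / (x - x^-1)))
           * (d - (x ^+ 4 + x ^- 4)) = 0.
    transitivity ((x ^+ 12 * x ^- 4 * (x ^+ 12 * x ^- 4 - 1) * y -
      (1 + x ^+ 12) * (1 - x ^- 4)
      * (x ^+ 12 * x ^- 4 * z - ((x ^+ 12 * x ^- 4) ^+ 2 - 1)))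
        / (x ^+ 8 * (x ^+ 8 - 1))).
      rewrite yE dE; field.
      by rewrite x0 -?expr2 -?exprM !xn.
    by rewrite lin subrr mul0r.
  by move/eqP; rewrite mulf_eq0 (subr_eq0 d) (negPf d4) orbF.
split=> //; rewrite yE dE zE; field.
by rewrite x0 -?expr2 -?exprM !xn.
Qed.

Lemma delta_closed_form :
  delta = (q ^+ 8 + 1) * (q ^+ 12 - q ^+ 6 + 1) * (q ^+ 26 - 1)
    / (q ^+ 22 * (q ^+ 2 - 1)).
Proof. exact: (loop_closed_form q_neq0 qX_sub1_neq0). Qed.

Lemma phi_closed_form :
  phi = (q ^+ 8 - q ^+ 4 + 1) * (q ^+ 14 - 1) / (q ^+ 10 * (q ^+ 2 - 1)).
Proof. exact: (bigon_closed_form q_neq0 qX_sub1_neq0). Qed.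

Lemma phi_neq0 : phi != 0.
Proof.
have n0 : q ^+ 8 - q ^+ 4 + 1 != 0.
  rewrite /q -!rmorphXn -rmorphB -(rmorph1 (@tofrac {poly rat})) -rmorphD.
  by rewrite tofrac_neq0 // !hornerE.
rewrite phi_closed_form; apply: mulf_neq0.
  by apply: mulf_neq0; [exact: n0 | exact: qX_sub1_neq0].
rewrite invr_eq0; apply: mulf_neq0; [exact: qX_neq0 | exact: qX_sub1_neq0].
Qed.

Lemma loop_shift (F : fieldType) (x d : F) :
  x != 0 -> x ^+ 2 - 1 != 0 ->
  d = (x ^+ 8 + 1) * (x ^+ 12 - x ^+ 6 + 1) * (x ^+ 26 - 1)
    / (x ^+ 22 * (x ^+ 2 - 1)) ->
  (d - 1 + x ^+ 12 + x ^- 12) * (x ^+ 22 * (x ^+ 2 - 1)) =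
  (x ^+ 8 + 1) * (x ^+ 12 - x ^+ 6 + 1) * (x ^+ 26 - 1)
    + (x ^+ 34 - x ^+ 22 + x ^+ 10) * (x ^+ 2 - 1).
Proof. by move=> x0 x2 ->; field; rewrite x0 x2. Qed.

(** This serves to exclude z2 = 0. *)
Lemma delta_neq : delta - 1 + tau + tau^-1 != 0.
Proof.
have := loop_shift q_neq0 (qX_sub1_neq0 1) delta_closed_form.
rewrite /tau; set u := _ - 1 + _ + _; apply: contra_eq_neq => ->.
rewrite mul0r eq_sym /q.
rewrite -!(rmorphXn, rmorph1 (@tofrac {poly rat}), rmorphB, rmorphD, rmorphM).
(* At q = 0 this polynomial takes the value -1. *)
apply: tofrac_neq0.
rewrite !(hornerXn, hornerC, hornerD, hornerN, hornerM) !expr0n.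
by rewrite !(mul0r, mulr0, add0r, subr0, sub0r, addr0, mul1r, mulr1).
Qed.

(** * Diagrammatic identities *)

Local Open Scope mor_scope.

Lemma whiskerl n a b c (f : hom b c) (g : hom a b) :
  𝟙 n ⊗ (f ∘ g) = (𝟙 n ⊗ f) ∘ (𝟙 n ⊗ g).
Proof. by rewrite -interchange comp1f. Qed.

Lemma whiskerr n a b c (f : hom b c) (g : hom a b) :
  (f ∘ g) ⊗ 𝟙 n = (f ⊗ 𝟙 n) ∘ (g ⊗ 𝟙 n).
Proof. by rewrite -interchange comp1f. Qed.

Lemma slide a b c d (f : hom a b) (g : hom c d) :
  (f ⊗ 𝟙 d) ∘ (𝟙 a ⊗ g) = (𝟙 b ⊗ g) ∘ (f ⊗ 𝟙 c).
Proof. by rewrite -!interchange !comp1f !compf1. Qed.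

Local Notation L f := (tens (idm 1) f).
Local Notation R f := (tens f (idm 1)).

Lemma whiskerlr a b (f : hom a b) : L (R f) = R (L f).
Proof. by rewrite -[LHS](tensA (𝟙 1) f (𝟙 1)) cast_id. Qed.

Lemma whiskerll a b (f : hom a b) : L (L f) = 𝟙 2 ⊗ f.
Proof. by rewrite -[LHS](tensA (𝟙 1) (𝟙 1) f) cast_id tens_id. Qed.

Lemma whiskerrr a b (f : hom a b) :
  cast (esym (addnA a 1 1)) (esym (addnA b 1 1)) (R (R f)) = f ⊗ 𝟙 2.
Proof. by rewrite (tensA f (𝟙 1) (𝟙 1)) tens_id. Qed.

Lemma whiskerrr_mrg : R (R mrg) = mrg ⊗ 𝟙 2 :> hom 4 3.
Proof. by rewrite -whiskerrr cast_id. Qed.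

Lemma whiskerrr_cap : R (R cap) = cap ⊗ 𝟙 2 :> hom 4 2.
Proof. by rewrite -whiskerrr cast_id. Qed.

Lemma whiskerrr_cup : R (R cup) = cup ⊗ 𝟙 2 :> hom 2 4.
Proof. by rewrite -whiskerrr cast_id. Qed.

Lemma whiskerrr_spl : R (R spl) = spl ⊗ 𝟙 2 :> hom 3 4.
Proof. by rewrite -whiskerrr cast_id. Qed.

Lemma whiskerrr_end (f : hom 2 2) : R (R f) = f ⊗ 𝟙 2 :> hom 4 4.
Proof. by rewrite -whiskerrr cast_id. Qed.

Lemma tensf1_cap : cap ⊗ 𝟙 0 = cap :> hom 2 0.
Proof. by rewrite -[RHS]tensf1 cast_id. Qed.
Lemma tensf1_mrg : mrg ⊗ 𝟙 0 = mrg :> hom 2 1.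
Proof. by rewrite -[RHS]tensf1 cast_id. Qed.

Lemma tensf1_end (f : hom 2 2) : f ⊗ 𝟙 0 = f :> hom 2 2.
Proof. by rewrite -[RHS]tensf1 cast_id. Qed.

Lemma zigzagl : R cap ∘ L cup = 𝟙 1 :> hom 1 1. Proof. by case: cap_cup. Qed.
Lemma zigzagr : L cap ∘ R cup = 𝟙 1 :> hom 1 1. Proof. by case: cap_cup. Qed.
Lemma splE' : spl = R mrg ∘ L cup :> hom 1 2. Proof. exact: splE2. Qed.

(** Of the two rotations of m that define s, the one is chosen whose cup straightens against this
    cap; [mrg_splr] uses the other. *)
Lemma mrg_spll : L cap ∘ R spl = mrg :> hom 2 1.
Proof.
rewrite splE' whiskerr compA whiskerrr_mrg.
have := slide mrg cap; rewrite tensf1_mrg => <-.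
rewrite -compA -whiskerlr -whiskerll -whiskerl zigzagr tens_id.
exact: compf1.
Qed.

Lemma mrg_splr : R cap ∘ L spl = mrg :> hom 2 1.
Proof.
rewrite /spl whiskerl compA whiskerll.
have := slide cap mrg; rewrite tens1f => ->.
rewrite -compA (whiskerlr cup) -whiskerrr_cap -(whiskerr 1 (R cap) (L cup)).
rewrite zigzagl tens_id.
exact: compf1.
Qed.

(** Both sides are two caps side by side above a split of the middle strand. *)
Lemma cap_mrg : cap ∘ R mrg = cap ∘ L mrg :> hom 3 0.
Proof.
rewrite -[in LHS]mrg_splr whiskerr whiskerrr_cap compA.
rewrite -[in RHS]mrg_spll (whiskerl 1 (L cap) (R spl)) compA.
have := slide cap cap; rewrite tensf1_cap tens1f => <-.
by rewrite whiskerll -!compA (whiskerlr spl).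
Qed.

Lemma mrg_spl : mrg ∘ spl = phi *: 𝟙 1. Proof. by case: local_relations. Qed.
Lemma cap_sigmap : cap ∘ sigmap = beta *: cap. Proof. by case: local_relations. Qed.
Lemma mrg_sigmap : mrg ∘ sigmap = tau *: mrg. Proof. by case: local_relations. Qed.
Lemma cap_cup_loop : cap ∘ cup = delta *: 𝟙 0. Proof. by case: local_relations. Qed.
Lemma mrg_cup : mrg ∘ cup = 0. Proof. by case: local_relations. Qed.

Lemma cap_HH : cap ∘ HH = phi *: cap.
Proof.
rewrite /HH compA cap_mrg -compA -(whiskerl 1 mrg spl) mrg_spl tensZr tens_id compZr.
by congr (_ *: _); exact: compf1.
Qed.

Lemma UU_HH : UU ∘ HH = phi *: UU.
Proof. by rewrite /UU -compA cap_HH compZr. Qed.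

Lemma comp0f a b c (g : hom a b) : (0 : hom b c) ∘ g = 0.
Proof. by rewrite -(scale0r (0 : hom b c)) compZl scale0r. Qed.

Lemma compf0 a b c (f : hom b c) : f ∘ (0 : hom a b) = 0.
Proof. by rewrite -(scale0r (0 : hom a b)) compZr scale0r. Qed.

Lemma tens0f a b c d (g : hom c d) : (0 : hom a b) ⊗ g = 0.
Proof. by rewrite -(scale0r (0 : hom a b)) tensZl scale0r. Qed.

Lemma cap_spl : cap ∘ spl = 0.
Proof.
by rewrite /spl compA -cap_mrg -compA -(whiskerr 1 mrg cup) mrg_cup tens0f compf0.
Qed.

Lemma UU_NN : UU ∘ NN = 0.
Proof. by rewrite /UU /NN -compA (compA cap) cap_spl comp0f compf0. Qed.

Lemma NN_UU : NN ∘ UU = 0.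
Proof. by rewrite /UU /NN -compA (compA mrg) mrg_cup comp0f compf0. Qed.

Lemma NN_NN : NN ∘ NN = phi *: NN.
Proof. by rewrite /NN -compA (compA mrg) mrg_spl compZl comp1f compZr. Qed.

Lemma UU_UU : UU ∘ UU = delta *: UU.
Proof. by rewrite /UU -compA (compA cap) cap_cup_loop compZl comp1f compZr. Qed.

(** * Quarter turns of endomorphisms of the tensor square *)

Definition rotated (f g : hom 2 2) : Prop := L cap ∘ R f = R cap ∘ L g :> hom 3 1.

Definition quarter_turn (f : hom 2 2) : hom 2 2 :=
  (𝟙 2 ⊗ cap) ∘ L (R f) ∘ (cup ⊗ 𝟙 2).

(** [rotated] has the form of the relation between caps and crossings, while [quarter_turn] is a
    linear map under which ideals are stable; a zigzag links the two. *)
Lemma quarter_turnP f g : rotated f g -> quarter_turn f = g.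
Proof.
move=> fg; rewrite /quarter_turn compA -whiskerll -(whiskerl 1 (L cap) (R f)) fg.
rewrite (whiskerl 1 (R cap) (L g)) -compA whiskerll.
have := slide cup g; rewrite tens1f => <-.
rewrite compA (whiskerlr cap) -whiskerrr_cup -(whiskerr 1 (L cap) (R cup)).
by rewrite zigzagr tens_id; exact: comp1f.
Qed.

Lemma rotated_id : rotated (𝟙 2) UU.
Proof.
rewrite /rotated /UU whiskerl compA zigzagl !tens_id.
by rewrite comp1f; exact: compf1.
Qed.

Lemma rotated_UU : rotated UU (𝟙 2).
Proof.
rewrite /rotated /UU whiskerr compA zigzagr !tens_id.
by rewrite comp1f; apply/esym; exact: compf1.
Qed.

Lemma rotated_sigmap : rotated sigmap sigmam.
Proof. by case: cap_sigma. Qed.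

Lemma rotated_sigmam : rotated sigmam sigmap.
Proof. by case: cap_sigma. Qed.

Lemma cap_NN : L cap ∘ R NN = mrg ∘ R mrg :> hom 3 1.
Proof. by rewrite /NN whiskerr compA mrg_spll. Qed.

Lemma cap_NNl : R cap ∘ L NN = mrg ∘ L mrg :> hom 3 1.
Proof. by rewrite /NN whiskerl compA mrg_splr. Qed.

Lemma cap_HHl : R cap ∘ L HH = mrg ∘ R mrg :> hom 3 1.
Proof.
rewrite HHE whiskerl compA whiskerll.
have := slide cap mrg; rewrite tens1f => ->.
by rewrite -compA (whiskerlr spl) -whiskerrr_cap -(whiskerr 1 (R cap) (L spl)) mrg_splr.
Qed.

Lemma cap_HHr : L cap ∘ R HH = mrg ∘ L mrg :> hom 3 1.
Proof.
rewrite /HH whiskerr compA whiskerrr_mrg.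
have := slide mrg cap; rewrite tensf1_mrg => <-.
by rewrite -compA -whiskerll -(whiskerlr spl) -(whiskerl 1 (L cap) (R spl)) mrg_spll.
Qed.

Lemma rotated_NN : rotated NN HH.
Proof. by rewrite /rotated cap_NN cap_HHl. Qed.

Lemma rotated_HH : rotated HH NN.
Proof. by rewrite /rotated cap_HHr cap_NNl. Qed.

(** Once the upper H is absorbed into the cap, both sides contain two merges side by side above a
    split of the middle strand. *)
Lemma rotated_square : rotated (HH ∘ HH) (HH ∘ HH).
Proof.
rewrite /rotated whiskerr whiskerl !compA cap_HHl cap_HHr -!compA; congr (_ ∘ _).
rewrite {1}/HH HHE (whiskerr 1 (R mrg) (L spl)) (whiskerl 1 (L mrg) (R spl)).
rewrite !compA whiskerrr_mrg whiskerll.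
by have := slide mrg mrg => ->; rewrite (whiskerlr spl).
Qed.

(** * Crossings against cups, splits and merges *)

Lemma sigmapK : sigmam ∘ sigmap = 𝟙 2. Proof. by case: sigmaK. Qed.
Lemma sigmamK : sigmap ∘ sigmam = 𝟙 2. Proof. by case: sigmaK. Qed.


Lemma mrg_sigmam : mrg ∘ sigmam = tau^-1 *: mrg.
Proof.
rewrite -[RHS]compf1 -sigmamK compZl (compA mrg) mrg_sigmap compZl scalerA.
by rewrite mulVf ?tau_neq0 ?scale1r.
Qed.


Lemma rotated_cup f g : rotated f g -> R g ∘ L cup = L f ∘ R cup :> hom 1 3.
Proof.
move=> fg; set X := (X in X = _).
have R2cup : R (cup ⊗ 𝟙 2) = cup ⊗ 𝟙 3 :> hom 3 5.
  by have := tensA cup (𝟙 2) (𝟙 1); rewrite cast_id tens_id.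
have zigzag3 : L (cap ⊗ 𝟙 2) ∘ (cup ⊗ 𝟙 3) = 𝟙 3 :> hom 3 3.
  rewrite -R2cup -whiskerrr_cup -whiskerrr_cap (whiskerlr (R cap)) (whiskerlr cap).
  rewrite -(whiskerr 1 (R (L cap)) (R (R cup))) -(whiskerr 1 (L cap) (R cup)).
  by rewrite zigzagr !tens_id.
(* A zigzag inserted on the leftmost strand supplies the cap above [g] that [fg] needs. *)
have -> : X = (L (cap ⊗ 𝟙 2) ∘ (cup ⊗ 𝟙 3)) ∘ X.
  by rewrite zigzag3; apply/esym; exact: comp1f.
rewrite -compA; have := slide cup X; rewrite tens1f => ->.
rewrite compA -whiskerll -(whiskerl 1 (cap ⊗ 𝟙 2) (L X)).
rewrite /X (whiskerl 1 (R g) (L cup)) (whiskerlr g) -whiskerrr_cap.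
rewrite compA -(whiskerr 1 (R cap) (L g)) -fg (whiskerr 1 (L cap) (R f)) whiskerrr_end.
rewrite -compA whiskerll; have := slide f cup => ->.
rewrite tensf1_end compA -(whiskerlr cap) -whiskerll.
rewrite -(whiskerl 1 (R cap) (L cup)) zigzagl tens_id.
by congr (L _ ∘ _); exact: comp1f.
Qed.

(** A morphism 0 -> 2 is determined by bending its left leg down ([bend]). There sigma_+ turns into
    sigma_- at the cap and back into sigma_+ at the cup, where it meets a cap and gives beta. *)
Lemma sigmap_cup : sigmap ∘ cup = beta *: cup.
Proof.
have bend (f : hom 0 2) : f = R (L cap ∘ R f) ∘ cup :> hom 0 2.
  rewrite (whiskerr 1 (L cap) (R f)) -(whiskerlr cap) -compA.
  have -> : R (R f) = f ⊗ 𝟙 2 :> hom 2 4 by rewrite -whiskerrr cast_id.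
  have := slide f cup; rewrite tens1f => ->.
  have -> : f ⊗ 𝟙 0 = f by rewrite -[RHS]tensf1 cast_id.
  rewrite compA -whiskerll -(whiskerl 1 (R cap) (L cup)) zigzagl tens_id.
  by apply/esym; exact: comp1f.
rewrite [LHS]bend (whiskerr 1 sigmap cup) compA.
rewrite (_ : L cap ∘ R sigmap = R cap ∘ L sigmam :> hom 3 1); last first.
  exact: rotated_sigmap.
rewrite -compA -(rotated_cup rotated_sigmam) compA.
rewrite -(whiskerr 1 cap sigmap) cap_sigmap tensZl compZl zigzagl.
by rewrite tensZl compZl tens_id; congr (_ *: _); exact: comp1f.
Qed.

Lemma mrg_under : L mrg ∘ R sigmap = sigmap ∘ R mrg ∘ L sigmam :> hom 3 2.
Proof.
rewrite compA -[RHS](_ : (L mrg ∘ R sigmap ∘ L sigmap) ∘ L sigmam = _ :> hom 3 2).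
  rewrite -!compA -(whiskerl 1 sigmap sigmam) sigmamK tens_id.
  by congr (_ ∘ _); apply/esym; exact: compf1.
by rewrite mrg_sigma.
Qed.

(** With s written as a rotated merge, pulling the crossing through the vertex yields beta from the
    cup and tau^-1 from the merge, and beta tau^-1 = tau. *)
Lemma sigmap_spl : sigmap ∘ spl = tau *: spl.
Proof.
rewrite splE' compA -mrg_sigma -!compA -(whiskerl 1 sigmap cup) sigmap_cup.
rewrite tensZr !compZr (rotated_cup rotated_sigmam) compA.
rewrite -(whiskerl 1 mrg sigmam) mrg_sigmam tensZr compZl scalerA -splE' /spl.
by congr (_ *: _); rewrite beta_tau mulfK ?tau_neq0.
Qed.

(** In [sigma_spl] the single strand passes over the split; here it passes under. This follows from
    the slide past a merge by rotating the vertex. *)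
Lemma sigmap_spl_over : R sigmap ∘ L sigmap ∘ R spl = L spl ∘ sigmap :> hom 2 3.
Proof.
apply/esym.
rewrite [in LHS]splE' (whiskerl 1 (R mrg) (L cup)) (whiskerlr mrg) whiskerll -compA.
have := slide sigmap cup; rewrite tensf1_end => <-.
rewrite compA -whiskerrr_end -(whiskerr 1 (L mrg) (R sigmap)) mrg_under.
rewrite (whiskerr 1 sigmap (R mrg ∘ L sigmam)) (whiskerr 1 (R mrg) (L sigmam)).
rewrite -whiskerlr -whiskerll -!compA -(whiskerl 1 (R sigmam) (L cup)).
rewrite (rotated_cup rotated_sigmap) (whiskerl 1 (L sigmap) (R cup)) whiskerll.
rewrite whiskerrr_mrg (compA (mrg ⊗ 𝟙 2)); have := slide mrg sigmap => ->.
by rewrite -whiskerrr_mrg (whiskerlr cup) -compA -(whiskerr 1 (R mrg) (L cup)) -splE'.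
Qed.

(* The right-hand input of [f] comes from a split whose other branch merges with
   the right-hand output of [f]. *)
Definition wire (f : hom 2 2) : hom 2 2 := L mrg ∘ R f ∘ L spl.

Lemma wire_id : wire (𝟙 2) = phi *: 𝟙 2.
Proof.
rewrite /wire !tens_id comp1f -(whiskerl 1 mrg spl) mrg_spl tensZr.
by rewrite tens_id.
Qed.

Lemma wire_UU : wire UU = NN.
Proof.
by rewrite /wire /UU (whiskerr 1 cup cap) -compA mrg_splr compA.
Qed.

Lemma wire_NN : wire NN = HH ∘ HH.
Proof.
rewrite /wire /NN (whiskerr 1 spl mrg) -(compA (R spl)).
by rewrite (compA (L mrg) (R spl)) {1}HHE.
Qed.

(** In this form the skein relation below a merge ([mrg_skein]) applies to the wired H. *)
Lemma wire_HH : wire HH = L (mrg ∘ HH) ∘ R spl.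
Proof.
rewrite /wire [in LHS]HHE (whiskerr 1 (L mrg) (R spl)).
rewrite -(compA (R (L mrg))) whiskerrr_spl; have := slide spl spl => ->.
rewrite (compA (R (L mrg))) -(whiskerlr mrg) -whiskerll -(whiskerl 1 (R mrg) (L spl)).
by rewrite (compA (L mrg)) -(whiskerl 1 mrg (R mrg ∘ L spl)).
Qed.

(** Sliding the split through the crossing leaves sigma_- directly below the merge, whence tau^-1;
    for [wire sigmam] it leaves sigma_+ and tau. *)
Lemma wire_sigmap : wire sigmap = tau^-1 *: (HH ∘ sigmap).
Proof.
have E : R sigmap ∘ L spl = L sigmam ∘ R spl ∘ sigmap :> hom 2 3.
  rewrite -sigma_spl compA -(whiskerl 1 sigmam sigmap) sigmapK tens_id.
  by apply/esym; exact: comp1f.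
rewrite /wire E compA -(whiskerl 1 mrg sigmam) mrg_sigmam tensZr compZl.
by rewrite compA -HHE.
Qed.

Lemma wire_sigmam : wire sigmam = tau *: (HH ∘ sigmam).
Proof.
have E : R sigmam ∘ L spl = L sigmap ∘ R spl ∘ sigmam :> hom 2 3.
  have -> : L spl = (R sigmap ∘ L sigmap ∘ R spl) ∘ sigmam :> hom 2 3.
    by rewrite sigmap_spl_over -compA sigmamK; apply/esym; exact: compf1.
  rewrite !compA -(whiskerr 1 sigmam sigmap) sigmapK tens_id.
  by congr ((_ ∘ _) ∘ _); exact: comp1f.
rewrite /wire E compA -(whiskerl 1 mrg sigmap) mrg_sigmap tensZr compZl.
by rewrite compA -HHE.
Qed.

(** * Linear functionals on the quotient *)

(** Spanning gives coordinates only by choice; independence makes them unique and therefore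
    linear. *)
Lemma basis_coord (F : fieldType) (V : lmodType F) (e : seq V) :
  is_basis e -> exists c : 'I_(size e) -> {linear V -> F^o},
    (forall i j : 'I_(size e), c i e`_j = (i == j)%:R) /\
    (forall v, v = \sum_(i < size e) c i v *: e`_i).
Proof.
case=> free span; have [c cE] := choice span.
have c_inj (a b : 'I_(size e) -> F) :
    \sum_(i < size e) a i *: e`_i = \sum_(i < size e) b i *: e`_i -> a =1 b.
  move=> ab i; apply/eqP; rewrite -subr_eq0; apply/eqP.
  apply: (free (fun i => a i - b i)).
  under eq_bigr do rewrite scalerBl.
  by rewrite sumrB ab subrr.
have c_lin i : linear (c^~ i : V -> F^o).
  move=> k u v; apply: (c_inj _ (fun i => k * c u i + c v i)).
  under [RHS]eq_bigr do rewrite scalerDl -scalerA.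
  by rewrite big_split -scaler_sumr -!cE.
exists (fun i => HB.pack_for {linear V -> F^o} (c^~ i : V -> F^o)
  (GRing.isLinear.Build F V F^o *:%R _ (c_lin i))); split=> [i j|v] //=.
apply: (c_inj (c e`_j) (fun i => (i == j)%:R)).
rewrite -cE (bigD1 j) //= eqxx scale1r big1 ?addr0 // => k /negPf->.
by rewrite scale0r.
Qed.

(** Evaluating functionals of the quotient on representatives allows all diagram identities to be
    used in T itself. *)
Definition ev I (g : {linear qhom I 2 2 -> K^o}) (f : hom 2 2) : K :=
  g (qcls I f).

Lemma evD I (g : {linear qhom I 2 2 -> K^o}) (f f' : hom 2 2) :
  ev g (f + f') = ev g f + ev g f'.
Proof. by rewrite /ev !linearD. Qed.

Lemma evB I (g : {linear qhom I 2 2 -> K^o}) (f f' : hom 2 2) :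
  ev g (f - f') = ev g f - ev g f'.
Proof. by rewrite /ev !linearB. Qed.

Lemma evZ I (g : {linear qhom I 2 2 -> K^o}) k (f : hom 2 2) :
  ev g (k *: f) = k * ev g f.
Proof. by rewrite /ev !linearZ. Qed.

Definition evE := (evB, evD, evZ).

Lemma ev_ideal I (g : {linear qhom I 2 2 -> K^o}) (f : hom 2 2) :
  ideal_mem I f -> ev g f = 0.
Proof.
move=> If; rewrite /ev; have -> : qcls I f = qcls I 0 by apply/qclsP; rewrite subr0.
by rewrite !linear0.
Qed.

Definition skein_defect (z1 z2 : K) : hom 2 2 :=
  sigmap - sigmam - z1 *: (𝟙 2 - UU) - z2 *: (HH - NN).

Lemma comp_skeinl z1 z2 a (f : hom 2 a) :
  f ∘ skein_defect z1 z2 =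
  f ∘ sigmap - f ∘ sigmam - z1 *: (f - f ∘ UU) - z2 *: (f ∘ HH - f ∘ NN).
Proof.
by rewrite /skein_defect -!scaleN1r !(compDr, compZr, scalerDr) compf1.
Qed.

Lemma comp_skeinr z1 z2 a (f : hom a 2) :
  skein_defect z1 z2 ∘ f =
  sigmap ∘ f - sigmam ∘ f - z1 *: (f - UU ∘ f) - z2 *: (HH ∘ f - NN ∘ f).
Proof.
by rewrite /skein_defect -!scaleN1r !(compDl, compZl, scalerDr) comp1f.
Qed.

Fact wire_linear : linear wire.
Proof.
by move=> k f g; rewrite /wire tensDl tensZl compDl compDr compZl compZr.
Qed.
HB.instance Definition _ :=
  GRing.isLinear.Build K (hom 2 2) (hom 2 2) _ wire wire_linear.

Fact quarter_turn_linear : linear quarter_turn.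
Proof.
move=> k f g.
by rewrite /quarter_turn tensDl tensZl tensDr tensZr compDl compDr compZl compZr.
Qed.
HB.instance Definition _ :=
  GRing.isLinear.Build K (hom 2 2) (hom 2 2) _ quarter_turn quarter_turn_linear.

Lemma wire_ideal I f : ideal_mem I f -> ideal_mem I (wire f).
Proof.
move=> If; apply: ideal_compl; apply: ideal_compr.
exact: (ideal_tensr (𝟙 1) If).
Qed.

Lemma quarter_turn_ideal I f : ideal_mem I f -> ideal_mem I (quarter_turn f).
Proof.
move=> If; apply: ideal_compl; apply: ideal_compr.
exact: (ideal_tensl (𝟙 1) (ideal_tensr (𝟙 1) If)).
Qed.

Lemma sigmam_eigenl a k (f : hom a 2) :
  k != 0 -> sigmap ∘ f = k *: f -> sigmam ∘ f = k^-1 *: f.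
Proof.
move=> k0 sf; rewrite -[in RHS](comp1f f) -sigmapK -compA sf compZr scalerA.
by rewrite mulVf ?scale1r.
Qed.

Lemma sigmam_eigenr a k (f : hom 2 a) :
  k != 0 -> f ∘ sigmap = k *: f -> f ∘ sigmam = k^-1 *: f.
Proof.
move=> k0 sf; rewrite -[in RHS](compf1 f) -sigmamK compA sf compZl scalerA.
by rewrite mulVf ?scale1r.
Qed.

Lemma sigmap_UU : sigmap ∘ UU = beta *: UU.
Proof. by rewrite /UU compA sigmap_cup compZl. Qed.

Lemma UU_sigmap : UU ∘ sigmap = beta *: UU.
Proof. by rewrite /UU -compA cap_sigmap compZr. Qed.

Lemma sigmap_NN : sigmap ∘ NN = tau *: NN.
Proof. by rewrite /NN compA sigmap_spl compZl. Qed.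

Lemma NN_sigmap : NN ∘ sigmap = tau *: NN.
Proof. by rewrite /NN -compA mrg_sigmap compZr. Qed.

Lemma mrg_skein z1 z2 (l := tau - tau^-1 - z1 + z2 * phi) :
  mrg ∘ skein_defect z1 z2 = l *: mrg - z2 *: (mrg ∘ HH).
Proof.
rewrite comp_skeinl mrg_sigmap mrg_sigmam /UU /NN (compA mrg cup) mrg_cup comp0f.
rewrite (compA mrg spl) mrg_spl compZl comp1f subr0 scalerBr scalerA /l.
by rewrite scalerDl !scalerBl opprB addrA (addrAC _ (_ *: mrg)).
Qed.

(* [eX] is the value on the diagram X of a functional vanishing on U and N, where
   s, t and T stand for sigma_+, sigma_- and [wire HH]. *)
Lemma skein_elimination (F : fieldType)
    (t z1 z2 p e1 es et eH ess ett eHs eHt eHH eHU eHN eT : F)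
    (l := t - t^-1 - z1 + z2 * p) :
  z2 != 0 ->
  t^-1 * eHs - t * eHt - z1 * (p * e1) - z2 * (eT - eHH) = 0 ->
  l * eH - z2 * eT = 0 ->
  ess - e1 - z1 * es - z2 * eHs = 0 ->
  e1 - ett - z1 * et - z2 * eHt = 0 ->
  eHs - eHt - z1 * (eH - eHU) - z2 * (eHH - eHN) = 0 ->
  z2 * eHU = 0 -> z2 * eHN = 0 ->
  es - et - z1 * e1 - z2 * eH = 0 ->
  [/\ (1 + t^-1) * ess + (1 + t) * ett =
      (t + t^-1 + 2%:R + z1 * (z2 * p) - l * z1 - z1 ^+ 2) * e1
      + (t^-1 * z1 + l + z1 *+ 2) * es - (t * z1 + l + z1 *+ 2) * et,
    z2 ^+ 2 * eHH = ess + ett - (2%:R - z1 ^+ 2) * e1 - z1 *+ 2 * (es - et)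
  & z2 * eH = es - et - z1 * e1 /\ z2 * eHt = e1 - ett - z1 * et].
Proof.
move=> z20 E1 E2 E3 E4 E5 /eqP E6 /eqP E7 E8.
move: E6 E7; rewrite !mulf_eq0 (negPf z20) /= => /eqP E6 /eqP E7; subst eHU eHN.
have esE : es = et + z1 * e1 + z2 * eH by rewrite -[LHS]subr0 -E8; ring.
have essE : ess = e1 + z1 * es + z2 * eHs by rewrite -[LHS]subr0 -E3; ring.
have ettE : ett = e1 - z1 * et - z2 * eHt by rewrite -[LHS]addr0 -E4; ring.
have eHsE : eHs = eHt + z1 * eH + z2 * eHH by rewrite -[LHS]subr0 -E5; ring.
(* [E1 - E2] removes the wired H. *)
have E12 : t^-1 * eHs - t * eHt - z1 * (p * e1) - l * eH + z2 * eHH = 0.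
  by rewrite -[LHS]addr0 -{1}E2 -[RHS]E1; ring.
split; last by split; [rewrite esE; ring | rewrite ettE; ring].
  apply/eqP; rewrite -subr_eq0; apply/eqP.
  rewrite -[RHS](mulr0 z2) -E12 /l essE ettE eHsE esE; ring.
by rewrite essE ettE eHsE esE; ring.
Qed.

(** The hypotheses of [skein_elimination] are the values of [g] on elements of the ideal obtained
    from the skein relation: wired, put below a merge, multiplied by sigma_+, sigma_-, H, U and N,
    and unchanged. *)
Lemma functional_elimination (I : tensor_ideal) (z1 z2 : K)
    (l := tau - tau^-1 - z1 + z2 * phi) (g : {linear qhom I 2 2 -> K^o}) :
  z2 != 0 -> ideal_mem I (skein_defect z1 z2) ->
  ev g UU = 0 -> ev g NN = 0 ->
  [/\ (1 + tau^-1) * ev g (sigmap ∘ sigmap) + (1 + tau) * ev g (sigmam ∘ sigmam) =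
      (tau + tau^-1 + 2%:R + z1 * (z2 * phi) - l * z1 - z1 ^+ 2) * ev g (𝟙 2)
      + (tau^-1 * z1 + l + z1 *+ 2) * ev g sigmap
      - (tau * z1 + l + z1 *+ 2) * ev g sigmam,
    z2 ^+ 2 * ev g (HH ∘ HH) = ev g (sigmap ∘ sigmap) + ev g (sigmam ∘ sigmam)
      - (2%:R - z1 ^+ 2) * ev g (𝟙 2) - z1 *+ 2 * (ev g sigmap - ev g sigmam)
  & z2 * ev g HH = ev g sigmap - ev g sigmam - z1 * ev g (𝟙 2) /\
    z2 * ev g (HH ∘ sigmam) =
      ev g (𝟙 2) - ev g (sigmam ∘ sigmam) - z1 * ev g sigmam].
Proof.
move=> z20 skein U0 N0.
have evr (f : hom 2 2) := ev_ideal g (ideal_compr f skein).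
have evl (f : hom 2 2) := ev_ideal g (ideal_compl f skein).
apply: (skein_elimination (eHs := ev g (HH ∘ sigmap)) (eHt := ev g (HH ∘ sigmam))
  (eHU := ev g (HH ∘ UU)) (eHN := ev g (HH ∘ NN)) (eT := ev g (wire HH)) z20).
- have := ev_ideal g (wire_ideal skein); rewrite /skein_defect.
  have tB f f' : wire (f - f') = wire f - wire f' by rewrite linearB.
  have tZ k f : wire (k *: f) = k *: wire f by rewrite linearZ.
  rewrite !tB !tZ !tB.
  rewrite wire_sigmap wire_sigmam wire_id wire_UU wire_NN.
  by rewrite !evE N0 subr0.
- have := ev_ideal g (ideal_compr (R spl) (ideal_tensl (𝟙 1) (ideal_compl mrg skein))).
  rewrite mrg_skein -scaleN1r tensDr !tensZr compDl !compZl scaleN1r -HHE.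
  by rewrite -wire_HH evE !evZ.
- have := evr sigmap; rewrite comp_skeinr sigmapK UU_sigmap NN_sigmap !evE.
  by rewrite U0 N0 !mulr0 !subr0.
- have := evr sigmam.
  rewrite comp_skeinr sigmamK (sigmam_eigenr beta_neq0 UU_sigmap).
  rewrite (sigmam_eigenr tau_neq0 NN_sigmap) !evE.
  by rewrite U0 N0 !mulr0 !subr0.
- by have := evl HH; rewrite comp_skeinl !evE.
- have := evr UU.
  rewrite comp_skeinr sigmap_UU (sigmam_eigenl beta_neq0 sigmap_UU).
  rewrite UU_UU NN_UU subr0 !evE U0 !mulr0 !subr0 mulr0 !sub0r oppr0 sub0r.
  by move/eqP; rewrite oppr_eq0 => /eqP.
- have := evr NN.
  rewrite comp_skeinr sigmap_NN (sigmam_eigenl tau_neq0 sigmap_NN).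
  rewrite UU_NN NN_NN subr0 !evE N0 !mulr0 !subr0 sub0r.
  by move/eqP; rewrite oppr_eq0 => /eqP.
- by have := ev_ideal g skein; rewrite /skein_defect !evE U0 N0 !subr0.
Qed.

(** * Coordinates in the given basis and dual functionals *)

Local Notation o k := (@Ordinal 5 k isT).

Lemma end_coord (I : tensor_ideal) :
  is_basis [:: qcls I (𝟙 2); qcls I UU; qcls I HH; qcls I NN;
               qcls I (sigmap + sigmam)] ->
  exists c : 'I_5 -> {linear qhom I 2 2 -> K^o},
    (forall i, [/\ ev (c i) (𝟙 2) = (i == 0%N :> nat)%:R,
      ev (c i) UU = (i == 1%N :> nat)%:R,
      ev (c i) HH = (i == 2%N :> nat)%:R,
      ev (c i) NN = (i == 3%N :> nat)%:R &
      ev (c i) sigmap + ev (c i) sigmam = (i == 4%N :> nat)%:R]) /\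
    forall f (x := fun i => ev (c i) f),
      ideal_mem I (f - (x (o 0) *: 𝟙 2 + x (o 1) *: UU + x (o 2) *: HH
        + x (o 3) *: NN + x (o 4) *: (sigmap + sigmam))).
Proof.
case/basis_coord => c [cE vE]; exists c; split=> [i|f x].
  by split; [exact: (cE i (o 0)) | exact: (cE i (o 1)) | exact: (cE i (o 2))
    | exact: (cE i (o 3)) | rewrite -evD; exact: (cE i (o 4))].
apply/qclsP; rewrite [LHS]vE !big_ord_recl big_ord0 /= addr0 !addrA.
have qD u v : qcls I (u + v) = qcls I u + qcls I v :> qhom I 2 2 by rewrite linearD.
have qZ k u : qcls I (k *: u) = k *: qcls I u :> qhom I 2 2 by rewrite linearZ.
rewrite !qD !qZ !qD /x.
by congr (_ *: _ + _ *: _ + _ *: _ + _ *: _ + _ *: _); congr (c _ _); exact: val_inj.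
Qed.

Lemma quarter_turn_coord (x0 x1 x2 x3 x4 : K) :
  quarter_turn (x0 *: 𝟙 2 + x1 *: UU + x2 *: HH + x3 *: NN
    + x4 *: (sigmap + sigmam)) =
  x0 *: UU + x1 *: 𝟙 2 + x2 *: NN + x3 *: HH + x4 *: (sigmap + sigmam).
Proof.
have tD f g : quarter_turn (f + g) = quarter_turn f + quarter_turn g by rewrite linearD.
have tZ k f : quarter_turn (k *: f) = k *: quarter_turn f by rewrite linearZ.
rewrite !(tD, tZ) (quarter_turnP rotated_id) (quarter_turnP rotated_UU).
rewrite (quarter_turnP rotated_HH) (quarter_turnP rotated_NN).
rewrite (quarter_turnP rotated_sigmap) (quarter_turnP rotated_sigmam).
by rewrite (addrC sigmam).
Qed.

Lemma square_coord (I : tensor_ideal) :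
  is_basis [:: qcls I (𝟙 2); qcls I UU; qcls I HH; qcls I NN;
               qcls I (sigmap + sigmam)] ->
  exists x h w : K, ideal_mem I (HH ∘ HH -
    (x *: 𝟙 2 + x *: UU + h *: HH + h *: NN + w *: (sigmap + sigmam))).
Proof.
case/end_coord => c [cE /(_ (HH ∘ HH))]; set x := fun _ => _ => /= Ix.
have Ir := quarter_turn_ideal Ix.
have tB f g : quarter_turn (f - g) = quarter_turn f - quarter_turn g by rewrite linearB.
rewrite tB quarter_turn_coord (quarter_turnP rotated_square) in Ir.
(* H^2 is congruent to its turned expansion, so its coordinates can be read off there as well. *)
have xE i : x i = ev (c i) (x (o 0) *: UU + x (o 1) *: 𝟙 2 + x (o 2) *: NN
    + x (o 3) *: HH + x (o 4) *: (sigmap + sigmam)).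
  by apply/eqP; rewrite -subr_eq0 -evB; apply/eqP/ev_ideal.
have x10 : x (o 0) = x (o 1).
  rewrite xE !evE; case: (cE (o 0)) => -> -> -> -> -> /=.
  by rewrite !mulr0 mulr1 !addr0 add0r.
have x23 : x (o 2) = x (o 3).
  rewrite xE !evE; case: (cE (o 2)) => -> -> -> -> -> /=.
  by rewrite !mulr0 mulr1 !addr0 !add0r.
by exists (x (o 1)), (x (o 3)), (x (o 4)); rewrite -{1}x10 -{1}x23.
Qed.

Lemma eq_from_sum_diff (F : fieldType) (a b u v : F) : 2%:R != 0 :> F ->
  a + b = u + v -> a - b = u - v -> a = u /\ b = v.
Proof.
move=> n2 s d; have a2 : a = u.
  apply: (mulfI n2); transitivity ((a + b) + (a - b)); first by ring.
  by rewrite s d; ring.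
by split=> //; move: s; rewrite a2 => /addrI.
Qed.

Lemma coord_change (F : fieldType) (z1 z2 e1 et ett eHt x0 x2 x4 : F) :
  z2 != 0 -> z2 * eHt = e1 - ett - z1 * et ->
  x0 * et + x2 * eHt + x4 * (e1 + ett) =
    (x4 + z2^-1 * x2) * e1 + (x0 - z1 * z2^-1 * x2) * et
    + (x4 - z2^-1 * x2) * ett.
Proof.
move=> z20 E; have -> : eHt = (z2 * eHt) / z2 by rewrite mulrC mulKf.
by rewrite E; field.
Qed.

(** Modulo U and N, the elements 1, sigma_+, sigma_- are a basis, and [g1], [gs], [gt] are its dual
    basis. The last clause is the expansion of [f] multiplied by sigma_-, which preserves the lines
    of U and N. *)
Lemma dual_functionals (I : tensor_ideal) (z1 z2 : K) :
  2%:R != 0 :> K -> z2 != 0 -> ideal_mem I (skein_defect z1 z2) ->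
  is_basis [:: qcls I (𝟙 2); qcls I UU; qcls I HH; qcls I NN;
               qcls I (sigmap + sigmam)] ->
  exists g1 gs gt : {linear qhom I 2 2 -> K^o},
  [/\ [/\ ev g1 UU = 0, ev g1 NN = 0, ev g1 (𝟙 2) = 1, ev g1 sigmap = 0
          & ev g1 sigmam = 0],
      [/\ ev gs UU = 0, ev gs NN = 0, ev gs (𝟙 2) = 0, ev gs sigmap = 1
          & ev gs sigmam = 0],
      [/\ ev gt UU = 0, ev gt NN = 0, ev gt (𝟙 2) = 0, ev gt sigmap = 0
          & ev gt sigmam = 1] &
      forall (g : {linear qhom I 2 2 -> K^o}) f, ev g UU = 0 -> ev g NN = 0 ->
        ev g (f ∘ sigmam) = ev gs f * ev g (𝟙 2) + ev g1 f * ev g sigmam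
          + ev gt f * ev g (sigmam ∘ sigmam)].
Proof.
move=> n2 z20 skein /end_coord[c [cE fE]].
(* The coefficients come from H = (sigma_+ - sigma_- - z1) / z2 modulo U and N. *)
pose g1 : {linear qhom I 2 2 -> K^o} := c (o 0) \+ (- (z1 * z2^-1)) \*: c (o 2).
pose gs : {linear qhom I 2 2 -> K^o} := c (o 4) \+ z2^-1 \*: c (o 2).
pose gt : {linear qhom I 2 2 -> K^o} := c (o 4) \+ (- z2^-1) \*: c (o 2).
have g1E f : ev g1 f = ev (c (o 0)) f - z1 * z2^-1 * ev (c (o 2)) f.
  by rewrite /ev /= scaleNr.
have gsE f : ev gs f = ev (c (o 4)) f + z2^-1 * ev (c (o 2)) f by [].
have gtE f : ev gt f = ev (c (o 4)) f - z2^-1 * ev (c (o 2)) f.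
  by rewrite /ev /= scaleNr.
have diff (g : {linear qhom I 2 2 -> K^o}) : ev g sigmap - ev g sigmam =
    z1 * (ev g (𝟙 2) - ev g UU) + z2 * (ev g HH - ev g NN).
  by apply/eqP; rewrite -subr_eq0 opprD addrA -!evE; apply/eqP/ev_ideal.
have [c01 c0U c0H c0N c0S] := cE (o 0).
have [c21 c2U c2H c2N c2S] := cE (o 2).
have [c41 c4U c4H c4N c4S] := cE (o 4).
exists g1, gs, gt; split.
- have U0 : ev g1 UU = 0 by rewrite g1E c0U c2U mulr0 subrr.
  have N0 : ev g1 NN = 0 by rewrite g1E c0N c2N mulr0 subrr.
  have e1 : ev g1 (𝟙 2) = 1 by rewrite g1E c01 c21 mulr0 subr0.
  have S : ev g1 sigmap + ev g1 sigmam = 0 + 0.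
    by rewrite -evD g1E !evD c0S c2S mulr0 subrr addr0.
  have := diff g1; rewrite U0 N0 e1 (g1E HH) c0H c2H !subr0 sub0r !mulr1 mulrN.
  rewrite mulrCA mulfV // mulr1 subrr -[RHS](subrr 0) => D.
  by have [-> ->] := eq_from_sum_diff n2 S D.
- have U0 : ev gs UU = 0 by rewrite gsE c4U c2U mulr0 addr0.
  have N0 : ev gs NN = 0 by rewrite gsE c4N c2N mulr0 addr0.
  have e1 : ev gs (𝟙 2) = 0 by rewrite gsE c41 c21 mulr0 addr0.
  have S : ev gs sigmap + ev gs sigmam = 1 + 0.
    by rewrite -evD gsE !evD c4S c2S mulr0.
  have := diff gs; rewrite U0 N0 e1 (gsE HH) c4H c2H !subr0 mulr0 !add0r mulr1.
  rewrite mulfV // -[RHS](subr0 1) => D.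
  by have [-> ->] := eq_from_sum_diff n2 S D.
- have U0 : ev gt UU = 0 by rewrite gtE c4U c2U mulr0 subr0.
  have N0 : ev gt NN = 0 by rewrite gtE c4N c2N mulr0 subr0.
  have e1 : ev gt (𝟙 2) = 0 by rewrite gtE c41 c21 mulr0 subr0.
  have S : ev gt sigmap + ev gt sigmam = 0 + 1.
    by rewrite -evD gtE !evD c4S c2S mulr0 subr0 add0r.
  have := diff gt; rewrite U0 N0 e1 (gtE HH) c4H c2H !subr0 mulr0 add0r sub0r mulr1.
  rewrite mulrN mulfV // -[RHS]sub0r => D.
  by have [-> ->] := eq_from_sum_diff n2 S D.
move=> g f U0 N0.
have [_ _ [_ Hm]] := functional_elimination z20 skein U0 N0.
have := ev_ideal g (ideal_compr sigmam (fE f)); rewrite -scaleN1r.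
rewrite !(compDl, compZl) comp1f sigmamK (sigmam_eigenr beta_neq0 UU_sigmap).
rewrite (sigmam_eigenr tau_neq0 NN_sigmap) !evE U0 N0 !mulr0 !addr0 mulN1r.
move/eqP; rewrite subr_eq0 => /eqP->.
by rewrite g1E gsE gtE; exact: coord_change.
Qed.

(** * The scalar equations for z1 and z2 *)

Lemma eliminate_square (F : fieldType) (z1 z2 x h w e1 es et eH ess ett eHH : F) :
  z2 ^+ 2 * eHH = ess + ett - (2%:R - z1 ^+ 2) * e1 - z1 *+ 2 * (es - et) ->
  z2 * eH = es - et - z1 * e1 ->
  eHH = x * e1 + h * eH + w * (es + et) ->
  ess + ett = (2%:R - z1 ^+ 2 + z2 ^+ 2 * x - z2 * h * z1) * e1
    + (z1 *+ 2 + z2 ^+ 2 * w + z2 * h) * es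
    + (- z1 *+ 2 + z2 ^+ 2 * w - z2 * h) * et.
Proof.
move=> EHH EH eHHE.
transitivity (z2 ^+ 2 * eHH + (2%:R - z1 ^+ 2) * e1 + z1 *+ 2 * (es - et)).
  by rewrite EHH; ring.
rewrite eHHE; transitivity (z2 ^+ 2 * x * e1 + z2 * h * (z2 * eH)
  + z2 ^+ 2 * w * (es + et) + (2%:R - z1 ^+ 2) * e1 + z1 *+ 2 * (es - et)).
  by ring.
by rewrite EH; ring.
Qed.

Lemma eliminate_merge (F : fieldType) (z2 x h w l p t eNH eNHH : F) :
  l = z2 * eNH -> l * eNH = z2 * eNHH ->
  eNHH = x + h * (eNH + p) + w * (t + t^-1) ->
  l ^+ 2 = z2 ^+ 2 * x + z2 * h * (l + z2 * p) + z2 ^+ 2 * w * (t + t^-1).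
Proof.
move=> lE lE2 eE; transitivity (z2 * (l * eNH)); first by rewrite [in RHS]mulrCA -lE.
by rewrite lE2 eE lE; ring.
Qed.

(** This is the case z2 = 0: the relation below a merge forces z = t - t^-1, and capping off then
    gives (t^2 - 1) (d - 1 + t + t^-1) = 0. *)
Lemma degenerate_skein (F : fieldType) (t z d : F) :
  t != 0 -> t - 1 != 0 -> 1 + t != 0 -> d - 1 + t + t^-1 != 0 ->
  t - t^-1 - z = 0 -> t * t - (t * t)^-1 = z * (1 - d) -> False.
Proof.
move=> t0 t1 t1' dt E1 E2.
have zE : z = t - t^-1 by rewrite -[LHS]addr0 -E1; ring.
have : (t - 1) * (1 + t) * (d - 1 + t + t^-1) = 0.
  transitivity (t * (t * t - (t * t)^-1 - z * (1 - d))); last by rewrite E2 subrr mulr0.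
  by rewrite zE; field; rewrite t0.
by move/eqP; rewrite !mulf_eq0 (negPf t1) (negPf t1') (negPf dt).
Qed.

Lemma UU_skein I z1 z2 (g : {linear qhom I 2 2 -> K^o}) :
  ideal_mem I (skein_defect z1 z2) -> ev g UU = 1 ->
  beta - beta^-1 = z1 * (1 - delta) + z2 * phi.
Proof.
move=> skein U1; have := ev_ideal g (ideal_compl UU skein).
rewrite comp_skeinl UU_sigmap (sigmam_eigenr beta_neq0 UU_sigmap) UU_UU UU_HH.
rewrite UU_NN subr0 !evE U1 !mulr1 => /eqP.
by rewrite -addrA -opprD subr_eq0 => /eqP.
Qed.

Lemma NN_skein I z1 z2 (l := tau - tau^-1 - z1 + z2 * phi) a (f : hom a 2) :
  ideal_mem I (skein_defect z1 z2) ->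
  ideal_mem I (l *: (NN ∘ f) - z2 *: (NN ∘ HH ∘ f)).
Proof.
move=> skein; have := ideal_compr f (ideal_compl spl (ideal_compl mrg skein)).
rewrite mrg_skein -scaleN1r.
by rewrite !(compDr, compZr, compDl, compZl) scaleN1r /NN -!compA.
Qed.

Lemma skein_system (I : tensor_ideal) (z1 z2 : K) :
  ideal_mem I (skein_defect z1 z2) ->
  is_basis [:: qcls I (𝟙 2); qcls I UU; qcls I HH; qcls I NN;
               qcls I (sigmap + sigmam)] ->
  exists2 rho : K, tau * rho ^+ 3 = 1 &
    beta - beta^-1 = z1 * (1 - delta) + z2 * phi /\
    tau * rho * (tau * rho - 1) * (z2 * phi) =
      (1 + tau) * (1 - rho) * (tau * rho * z1 - ((tau * rho) ^+ 2 - 1)).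
Proof.
move=> skein basis; have n2 := natK_neq0 1.
have [c [cE _]] := end_coord basis.
have [_ U1 _ _ _] := cE (@Ordinal 5 1 isT).
have [N1 NU NH NN1 NS] := cE (@Ordinal 5 3 isT).
have loop := UU_skein skein U1.
pose gN := c (@Ordinal 5 3 isT).
have lE : tau - tau^-1 - z1 + z2 * phi = z2 * ev gN (NN ∘ HH).
  have := ev_ideal gN (NN_skein (𝟙 2) skein).
  by rewrite !compf1 !evE NN1 mulr1 => /eqP; rewrite subr_eq0 => /eqP.
have z20 : z2 != 0.
  apply/eqP => z20; move: lE loop; rewrite z20 !mul0r !addr0 beta_tau.
  exact: degenerate_skein tau_neq0 tau_sub1_neq0 tau_add1_neq0 delta_neq.
have [x [h [w sq]]] := square_coord basis.
have merge : (tau - tau^-1 - z1 + z2 * phi) ^+ 2 = z2 ^+ 2 * x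
    + z2 * h * ((tau - tau^-1 - z1 + z2 * phi) + z2 * phi)
    + z2 ^+ 2 * w * (tau + tau^-1).
  apply: (eliminate_merge lE (eNHH := ev gN (NN ∘ HH ∘ HH))).
    have := ev_ideal gN (NN_skein HH skein).
    by rewrite !evE => /eqP; rewrite subr_eq0 => /eqP.
  have := ev_ideal gN (ideal_compl NN sq); rewrite -scaleN1r.
  rewrite !(compDr, compZr) compf1 NN_UU NN_NN NN_sigmap.
  rewrite (sigmam_eigenr tau_neq0 NN_sigmap) scaler0 addr0 scaleN1r !evE NN1 !mulr1.
  rewrite mulN1r => /eqP; rewrite subr_eq0 => /eqP->.
  by rewrite (mulrDr h) addrA.
have [g1 [gs [gt [G1 Gs Gt dec]]]] := dual_functionals n2 z20 skein basis.
have sqE (g : {linear qhom I 2 2 -> K^o}) : ev g UU = 0 -> ev g NN = 0 ->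
    ev g (HH ∘ HH) = x * ev g (𝟙 2) + h * ev g HH + w * (ev g sigmap + ev g sigmam).
  move=> U0 N0; apply/eqP; rewrite -subr_eq0 -(ev_ideal g sq).
  by rewrite !evE U0 N0 !mulr0 !addr0.
have rel g (U0 : ev g UU = 0) (N0 : ev g NN = 0) :=
  let: And3 E1 E2 (conj E3 _) := functional_elimination z20 skein U0 N0 in
  conj E1 (eliminate_square E2 E3 (sqE g U0 N0)).
(* This expands sigma_+ = sigma_+^2 sigma_-; its three components become [ca], [cb] and [cc] of
   [scalar_system]. *)
have inv (g : {linear qhom I 2 2 -> K^o}) (U0 : ev g UU = 0) (N0 : ev g NN = 0) :
    ev g sigmap = ev gs (sigmap ∘ sigmap) * ev g (𝟙 2)
      + ev g1 (sigmap ∘ sigmap) * ev g sigmam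
      + ev gt (sigmap ∘ sigmap) * ev g (sigmam ∘ sigmam).
  by rewrite -dec // -compA sigmamK compf1.
case: G1 Gs Gt => U0 N0 e1 es et [Us Ns s1 ss st] [Ut Nt t1 ts tt].
have [Fb Eb] := rel g1 U0 N0; have [Fa Ea] := rel gs Us Ns.
have [Fc Ec] := rel gt Ut Nt.
have := inv g1 U0 N0; have := inv gs Us Ns; have := inv gt Ut Nt.
rewrite e1 es et s1 ss st t1 ts tt !(mulr0, mulr1, add0r, addr0).
rewrite e1 es et !(mulr0, mulr1, add0r, addr0, subr0, sub0r) in Fb Eb.
rewrite s1 ss st !(mulr0, mulr1, add0r, addr0, subr0, sub0r) in Fa Ea.
rewrite t1 ts tt !(mulr0, mulr1, add0r, addr0, subr0, sub0r) in Fc Ec.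
move=> /esym/eqP; rewrite addrC addr_eq0 => /eqP cc /esym ca.
move=> /esym/eqP; rewrite addrC addr_eq0 => /eqP cb.
have y0 : z2 * phi != 0 by apply: mulf_neq0 z20 phi_neq0.
have [rho3 lin] := scalar_system n2 tau_neq0 tau_sub1_neq0 tau_add1_neq0
  tau_sqr_neq0 y0 erefl merge Ea Ec Eb Fa Fc Fb ca cb cc.
(* The witness is the coefficient of sigma_+ in sigma_-^2. *)
by exists (ev gs (sigmam ∘ sigmam)).
Qed.

Theorem lemma4p1 (I : tensor_ideal) (z1 z2 : K)
  (hdelta1 : delta <> q ^+ 4 + q ^- 4)
  (hdelta2 : delta <> - q ^+ 16 - q ^- 16)
  (hbasis : is_basis [:: qcls I (idm 2); qcls I UU; qcls I HH; qcls I NN;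
                         qcls I (sigmap + sigmam)])
  (hz : qcls I sigmap - qcls I sigmam =
        z1 *: (qcls I (idm 2) - qcls I UU) + z2 *: (qcls I HH - qcls I NN)) :
  z1 = z2 /\ z2 = (q ^- 4 - q ^+ 4) / qint 3.
Proof.
have skein : ideal_mem I (skein_defect z1 z2).
  rewrite -[skein_defect _ _]subr0; apply/qclsP.
  have qB (u v : hom 2 2) : qcls I (u - v) = qcls I u - qcls I v by rewrite linearB.
  have qZ k (u : hom 2 2) : qcls I (k *: u) = k *: qcls I u by rewrite linearZ.
  rewrite /skein_defect !(qB, qZ) hz linear0 -addrA -opprD.
  exact: subrr.
have [rho rho3 [loop lin]] := skein_system skein hbasis.
(* As tau = q^12, the equation tau rho^3 = 1 says that rho q^4 is a cube root of unity. *)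
have rhoE : rho = q ^- 4.
  have : rho * q ^+ 4 = 1.
    by apply: cube_eq1; rewrite exprMn -exprM mulrC.
  by move=> rq; rewrite -[LHS](mulfK (qX_neq0 4)) rq mul1r.
have loop' : z2 * phi = tau * tau - (tau * tau)^-1 + z1 * (delta - 1).
  by rewrite -[delta - 1]opprB mulrN -beta_tau loop addrAC subrr add0r.
rewrite rhoE in lin.
have [z1E yE] := solve_linear (t := tau) q_neq0 qX_sub1_neq0 erefl delta_closed_form
  (introN eqP hdelta1) loop' lin.
have z12 : z2 = z1.
  by apply: (mulIf phi_neq0); rewrite yE -phi_closed_form mulrC.
by rewrite z12; split; [exact: erefl | exact: z1E].
Qed.
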